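(* Let $k$ be a commutative Noetherian ring and let $V$ be a finitely generated $\mathscr{C}$-module. Then there exists a complex of $\mathscr{C}$-modules $$F^\bullet:\quad 0\to V\to F^0\to F^1\to\dots\to F^n\to 0$$ satisfying the following conditions: (1) each $F^i$ is a $\sharp$-filtered module with $\mathrm{gd}(F^i)\leqslant\mathrm{gd}(V)-i$; (2) $n\leqslant\mathrm{gd}(V)$; (3) the homology in each degree of the complex is a torsion module, including the homology at $V$. In particular, $\Sigma_dV$ is a $\sharp$-filtered module for $d\gg 0$.
   Context: $\mathscr{C}$ is the category with objects $[n]=\{1,\dots,n\}$, $n\in\mathbb{Z}_+=\{0,1,2,\dots\}$ ($[0]=\emptyset$), and morphisms the injections (a skeleton of FI, the category of finite sets and injections); the object $[n]$ is also written $n$. $\underline{\mathscr{C}}$ is its $k$-linearization, so $\underline{\mathscr{C}}(i,j)$ is the free $k$-module on $\mathscr{C}(i,j)$, and $\underline{\mathscr{C}}(i,i)=kS_i$, where $S_i$ is the symmetric group on $i$ letters. A $\mathscr{C}$-module is a covariant functor $V$ from $\mathscr{C}$ to $k$-modules, $V_i$ being its value at $[i]$. It is finitely generated if it is a quotient of a finite direct sum of modules $\underline{\mathscr{C}}(i,-)$. A finitely generated $\mathscr{C}$-module $V$ is torsion if there is $N$ with $V_i=0$ for all $i\geqslant N$. The generating degree $\mathrm{gd}(V)$ is the largest $i$ with $H_0(V)_i\neq 0$ ($-\infty$ if $H_0(V)=0$), where $H_0(V)_i=V_i/\sum_{j<i}\underline{\mathscr{C}}(j,i)V_j$. A basic $\sharp$-filtered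 module is a $\mathscr{C}$-module of the form $\underline{\mathscr{C}}\otimes_{kS_i}T$, i.e. $m\mapsto \underline{\mathscr{C}}(i,m)\otimes_{kS_i}T$, for some $i\in\mathbb{Z}_+$ and some $kS_i$-module $T$. A finitely generated $\mathscr{C}$-module $V$ is $\sharp$-filtered if it has a finite filtration $0=V^{-1}\subseteq V^0\subseteq\dots\subseteq V^r=V$ by submodules such that each $V^{j+1}/V^j$ is isomorphic to a basic $\sharp$-filtered module (the zero module is $\sharp$-filtered). Shift functor: let $\iota:\mathscr{C}\to\mathscr{C}$ send $[i]$ to $[i+1]$ and an injection $\alpha:[i]\to[j]$ to $\iota(\alpha):[i+1]\to[j+1]$ with $\iota(\alpha)(1)=1$ and $\iota(\alpha)(r)=\alpha(r-1)+1$ for $r\geqslant 2$. Then $\Sigma V=V\circ\iota$, so $(\Sigma V)_i=V_{i+1}$. $\Sigma_d$ is the $d$-fold iterate of $\Sigma$. *)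

(* Defs.v *)
From HB Require Import structures.
From mathcomp Require Import all_boot all_order all_algebra.
From mathcomp Require Import boolp classical_sets constructive_ereal.

Set Implicit Arguments.
Unset Strict Implicit.
Unset Printing Implicit Defensive.

Import GRing.Theory.
Local Open Scope ring_scope.

Record submod (k : comPzRingType) (M : lmodType k) := Submod {
  submod_pred :> {pred M};
  submod_closedP : submod_closed submod_pred }.

HB.instance Definition _ (k : comPzRingType) (M : lmodType k) (S : submod M) :=
  GRing.isSubmodClosed.Build k M (submod_pred S)
    (GRing.submod_closed_semi (submod_closedP S)).

Section SubQuot.
Variables (k : comPzRingType) (M : lmodType k).
Implicit Types (S : submod M) (P : M -> Prop).

Definition subM S : Type := {x : M | x \in submod_pred S}.
HB.instance Definition _ S := SubChoice.on (subM S).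
HB.instance Definition _ S := [SubChoice_isSubLmodule of subM S by <:].

Definition quotM S : Type := {ideal_quot (submod_pred S)}.
HB.instance Definition _ S := GRing.Zmodule.on (quotM S).

Definition quot_pi S (x : M) : quotM S :=
  (\pi_({ideal_quot (submod_pred S)}) x)%qT.
Definition quot_repr S (x : quotM S) : M :=
  repr (x : {ideal_quot (submod_pred S)}).

Lemma quot_reprK S : cancel (@quot_repr S) (@quot_pi S).
Proof. exact: reprK. Qed.

Lemma quot_piE S x y : (quot_pi S x = quot_pi S y) <-> (x - y \in submod_pred S).
Proof. by rewrite Quotient.idealrBE; split=> /eqP. Qed.

Fact quot_pi_zmod_morphism S : zmod_morphism (quot_pi S).
Proof. by move=> x y; rewrite /quot_pi raddfB. Qed.

Definition quot_scale S (a : k) (x : quotM S) : quotM S :=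
  quot_pi S (a *: quot_repr x).

Fact quot_scale_pi S a x : quot_scale a (quot_pi S x) = quot_pi S (a *: x).
Proof.
apply/quot_piE; rewrite -scalerBr rpredZ //.
by apply/quot_piE; rewrite quot_reprK.
Qed.

Fact quot_scaleA S a b (x : quotM S) :
  quot_scale a (quot_scale b x) = quot_scale (a * b) x.
Proof. by rewrite -[x]quot_reprK !quot_scale_pi scalerA. Qed.

Fact quot_scale1 S : left_id 1 (@quot_scale S).
Proof. by move=> x; rewrite -[x]quot_reprK quot_scale_pi scale1r. Qed.

Fact quot_piD S : {morph quot_pi S : x y / x + y}.
Proof. by move=> x y; rewrite /quot_pi raddfD. Qed.

Fact quot_scaleDr S : right_distributive (@quot_scale S) +%R.
Proof.
move=> a x y; rewrite -[x]quot_reprK -[y]quot_reprK -quot_piD !quot_scale_pi.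
by rewrite scalerDr quot_piD.
Qed.

Fact quot_scaleDl S (x : quotM S) :
  {morph (@quot_scale S)^~ x : a b / a + b}.
Proof.
by move=> a b; rewrite -[x]quot_reprK !quot_scale_pi scalerDl quot_piD.
Qed.

HB.instance Definition _ S := GRing.Zmodule_isLmodule.Build k (quotM S)
  (@quot_scaleA S) (@quot_scale1 S) (@quot_scaleDr S) (@quot_scaleDl S).

HB.instance Definition _ S := GRing.isZmodMorphism.Build M (quotM S)
  (quot_pi S) (@quot_pi_zmod_morphism S).
Fact quot_pi_scalable S : scalable (quot_pi S).
Proof. by move=> a x; rewrite -quot_scale_pi. Qed.
HB.instance Definition _ S := GRing.isScalable.Build k M (quotM S) *:%R
  (quot_pi S) (@quot_pi_scalable S).

Definition submod_span_pred P : {pred M} :=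
  [pred x | `[< forall S, (forall y, P y -> y \in submod_pred S) ->
                  x \in submod_pred S >]].

Fact submod_span_closed P : submod_closed (submod_span_pred P).
Proof.
split=> [|a x y /asboolP Hx /asboolP Hy]; first by apply/asboolP => S _; exact: rpred0.
by apply/asboolP => S SP; rewrite rpredD ?rpredZ ?Hx ?Hy.
Qed.

Definition submod_span P : submod M := Submod (submod_span_closed P).

Lemma mem_submod_span P x : P x -> x \in submod_pred (submod_span P).
Proof. by move=> Px; apply/asboolP => S; apply. Qed.

Lemma submod_span_le P S : (forall y, P y -> y \in submod_pred S) ->
  forall x, x \in submod_pred (submod_span P) -> x \in submod_pred S.
Proof. by move=> PS x /asboolP; apply. Qed.

Definition nonzero : Prop := exists x : M, x <> 0.
End SubQuot.

Section Linear.
Variables (k : comPzRingType) (M N : lmodType k) (f : {linear M -> N}).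

Fact preim_closed (S : submod N) :
  submod_closed [pred x : M | f x \in submod_pred S].
Proof.
by split=> [|a x y Sx Sy]; rewrite inE (linear0, linearP) ?rpred0 ?rpredD ?rpredZ.
Qed.
Definition preim_submod (S : submod N) : submod M := Submod (preim_closed S).

Fact ker_closed : submod_closed [pred x : M | f x == 0].
Proof.
split=> [|a x y]; rewrite !inE ?linear0 // linearP => /eqP-> /eqP->.
by rewrite scaler0 addr0.
Qed.
Definition ker_submod : submod M := Submod ker_closed.

Fact im_closed : submod_closed [pred y : N | `[< exists x, y = f x >]].
Proof.
split=> [|a _ _ /asboolP[x ->] /asboolP[y ->]]; apply/asboolP.
  by exists 0; rewrite linear0.
by exists (a *: x + y); rewrite linearP.
Qed.
Definition im_submod : submod N := Submod im_closed.

Section SubMap.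
Variables (S : submod M) (S' : submod N).
Hypothesis fS : forall x, x \in submod_pred S -> f x \in submod_pred S'.

Definition sub_map (x : subM S) : subM S' := Sub (f (val x)) (fS (valP x)).
Fact sub_map_linear : linear sub_map.
Proof. by move=> a x y; apply: val_inj; rewrite /= !linearP. Qed.
HB.instance Definition _ := GRing.isLinear.Build k (subM S) (subM S') *:%R
  sub_map sub_map_linear.

Definition quot_map of (forall x, x \in submod_pred S -> f x \in submod_pred S') :=
  fun x : quotM S => quot_pi S' (f (quot_repr x)).

Lemma quot_map_pi x : quot_map fS (quot_pi S x) = quot_pi S' (f x).
Proof. by apply/quot_piE; rewrite -linearB fS //; apply/quot_piE/quot_reprK. Qed.

Fact quot_map_linear : linear (quot_map fS).
Proof.
move=> a x y; rewrite -[x]quot_reprK -[y]quot_reprK -linearP !quot_map_pi.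
by rewrite !linearP.
Qed.
HB.instance Definition _ := GRing.isLinear.Build k (quotM S) (quotM S') *:%R
  (quot_map fS) quot_map_linear.
End SubMap.
End Linear.

Definition noetherian (k : comPzRingType) : Prop :=
  forall I : submod k^o, exists s : seq k,
    submod_pred I =i submod_pred (submod_span (fun x : k^o => x \in s)).

(* The category C, with [n] = {1, ..., n} encoded as 'I_n = {0, ..., n - 1}. *)

Definition inj (m n : nat) := {f : {ffun 'I_m -> 'I_n} | injectiveb f}.

Definition inj_fun m n (f : inj m n) : 'I_m -> 'I_n := val f.
Coercion inj_fun : inj >-> Funclass.

Lemma inj_inj m n (f : inj m n) : injective f.
Proof. exact/injectiveP/(valP f). Qed.

Fact mk_inj_subproof m n (f : 'I_m -> 'I_n) :
  injective f -> injectiveb [ffun x => f x].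
Proof. by move=> fI; apply/injectiveP => x y; rewrite !ffunE => /fI. Qed.

Definition mk_inj m n (f : 'I_m -> 'I_n) (fI : injective f) : inj m n :=
  Sub [ffun x => f x] (mk_inj_subproof fI).

Lemma mk_injE m n (f : 'I_m -> 'I_n) (fI : injective f) : mk_inj fI =1 f.
Proof. by move=> x; rewrite /inj_fun /= ffunE. Qed.

Lemma inj_eqP m n (f g : inj m n) : f =1 g -> f = g.
Proof. by move=> fg; apply/val_inj/ffunP. Qed.

Definition inj1 n : inj n n := mk_inj (@inj_id 'I_n).
Definition injM m n p (g : inj n p) (f : inj m n) : inj m p :=
  mk_inj (inj_comp (@inj_inj _ _ g) (@inj_inj _ _ f)).

Lemma injME m n p (g : inj n p) (f : inj m n) x : injM g f x = g (f x).
Proof. exact: mk_injE. Qed.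

Lemma injM1 m n (f : inj m n) : injM (inj1 n) f = f.
Proof. by apply: inj_eqP => x; rewrite injME mk_injE. Qed.

Lemma injMA m n p q (h : inj p q) (g : inj n p) (f : inj m n) :
  injM (injM h g) f = injM h (injM g f).
Proof. by apply: inj_eqP => x; rewrite !injME. Qed.

Definition iota_fun m n (f : inj m n) (x : 'I_m.+1) : 'I_n.+1 :=
  if unlift ord0 x is Some y then lift ord0 (f y) else ord0.

Fact iota_fun_inj m n (f : inj m n) : injective (iota_fun f).
Proof.
move=> x y; rewrite /iota_fun.
by case: unliftP => [x'|] ->; case: unliftP => [y'|] -> // /lift_inj/inj_inj->.
Qed.

Definition inj_iota m n (f : inj m n) : inj m.+1 n.+1 := mk_inj (@iota_fun_inj m n f).

Lemma inj_iota0 m n (f : inj m n) : inj_iota f ord0 = ord0.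
Proof. by rewrite mk_injE /iota_fun unlift_none. Qed.

Lemma inj_iotaS m n (f : inj m n) x : inj_iota f (lift ord0 x) = lift ord0 (f x).
Proof. by rewrite mk_injE /iota_fun liftK. Qed.

Lemma inj_iota_id n : inj_iota (inj1 n) = inj1 n.+1.
Proof.
apply: inj_eqP => x; rewrite [RHS]mk_injE.
by case: (unliftP ord0 x) => [y|] ->; rewrite ?inj_iota0 // inj_iotaS mk_injE.
Qed.

Lemma inj_iota_comp m n p (g : inj n p) (f : inj m n) :
  inj_iota (injM g f) = injM (inj_iota g) (inj_iota f).
Proof.
apply: inj_eqP => x; rewrite injME.
by case: (unliftP ord0 x) => [y|] ->; rewrite ?inj_iota0 // !inj_iotaS injME.
Qed.

Record cmodule (k : comPzRingType) := Cmodule {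
  cm_obj :> nat -> lmodType k;
  cm_act : forall m n, inj m n -> {linear cm_obj m -> cm_obj n};
  cm_act1 : forall n x, cm_act (inj1 n) x = x;
  cm_actM : forall m n p (g : inj n p) (f : inj m n) x,
    cm_act (injM g f) x = cm_act g (cm_act f x) }.
Arguments cm_act {k} c {m n} f.

Record cmor (k : comPzRingType) (V W : cmodule k) := Cmor {
  cmor_at :> forall n, {linear V n -> W n};
  cmor_nat : forall m n (f : inj m n) x,
    cmor_at n (cm_act V f x) = cm_act W f (cmor_at m x) }.

Definition cm_iso (k : comPzRingType) (V W : cmodule k) : Prop :=
  exists (f : cmor V W) (g : cmor W V),
    (forall n, cancel (f n) (g n)) /\ (forall n, cancel (g n) (f n)).

Record submodule (k : comPzRingType) (V : cmodule k) := Submodule {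
  sm_at :> forall n, submod (V n);
  sm_act : forall m n (f : inj m n) x, x \in submod_pred (sm_at m) ->
    cm_act V f x \in submod_pred (sm_at n) }.

Section Constructions.
Variable k : comPzRingType.
Implicit Types V W : cmodule k.

Definition cm_zero : cmodule k :=
  @Cmodule k (fun=> 'rV[k]_0) (fun _ _ _ => idfun) (fun _ _ => erefl)
    (fun _ _ _ _ _ _ => erefl).

Section Sum.
Variables V W : cmodule k.
Definition sum_act m n (f : inj m n) (x : V m * W m) : V n * W n :=
  (cm_act V f x.1, cm_act W f x.2).
Fact sum_act_linear m n (f : inj m n) : linear (sum_act f).
Proof. by move=> a [x x'] [y y']; rewrite /sum_act /= !linearP. Qed.
HB.instance Definition _ m n (f : inj m n) :=
  GRing.isLinear.Build k (V m * W m)%type (V n * W n)%type *:%R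
    (sum_act f) (@sum_act_linear m n f).
Fact sum_act1 n x : sum_act (inj1 n) x = x.
Proof. by case: x => x y; rewrite /sum_act !cm_act1. Qed.
Fact sum_actM m n p (g : inj n p) (f : inj m n) x :
  sum_act (injM g f) x = sum_act g (sum_act f x).
Proof. by rewrite /sum_act !cm_actM. Qed.
Definition cm_sum : cmodule k :=
  @Cmodule k (fun n => (V n * W n)%type) (fun m n f => sum_act f)
    sum_act1 sum_actM.
End Sum.

Section Sub.
Variables (V : cmodule k) (W : submodule V).

Definition sub_act m n (f : inj m n) : {linear subM (W m) -> subM (W n)} :=
  sub_map (@sm_act k V W m n f).
Fact sub_act1 n x : sub_act (inj1 n) x = x.
Proof. by apply: val_inj; rewrite /= cm_act1. Qed.
Fact sub_actM m n p (g : inj n p) (f : inj m n) x :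
  sub_act (injM g f) x = sub_act g (sub_act f x).
Proof. by apply: val_inj; rewrite /= cm_actM. Qed.
Definition cm_sub : cmodule k := Cmodule sub_act1 sub_actM.

Definition quot_act m n (f : inj m n) : {linear quotM (W m) -> quotM (W n)} :=
  quot_map (@sm_act k V W m n f).
Fact quot_act1 n x : quot_act (inj1 n) x = x.
Proof. by rewrite -[x]quot_reprK /= quot_map_pi cm_act1. Qed.
Fact quot_actM m n p (g : inj n p) (f : inj m n) x :
  quot_act (injM g f) x = quot_act g (quot_act f x).
Proof. by rewrite -[x]quot_reprK /= !quot_map_pi cm_actM. Qed.
Definition cm_quot : cmodule k := Cmodule quot_act1 quot_actM.
End Sub.

Definition sm_restrict V (W' W : submodule V) : submodule (cm_sub W').
Proof.
exists (fun n => preim_submod (val : {linear subM (W' n) -> V n}) (W n)).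
by move=> m n f x; rewrite !inE; apply: sm_act.
Defined.

(* W' / (W' `&` W), that is W' / W when W is contained in W'. *)
Definition cm_subquot V (W' W : submodule V) : cmodule k :=
  cm_quot (sm_restrict W' W).

Definition cm_ker V W (f : cmor V W) : submodule V.
Proof.
exists (fun n => ker_submod (f n)).
by move=> m n g x; rewrite !inE cmor_nat => /eqP->; rewrite linear0.
Defined.

Definition cm_im V W (f : cmor V W) : submodule W.
Proof.
exists (fun n => im_submod (f n)).
move=> m n g _ /asboolP[x ->]; apply/asboolP.
by exists (cm_act V g x); rewrite cmor_nat.
Defined.

Definition homology U V W (f : cmor U V) (g : cmor V W) : cmodule k :=
  cm_subquot (cm_ker g) (cm_im f).

Definition cm_shift V : cmodule k.
Proof.
exists (fun n => V n.+1) (fun m n f => cm_act V (inj_iota f)).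
- by move=> n x; rewrite inj_iota_id cm_act1.
- by move=> m n p g f x; rewrite inj_iota_comp cm_actM.
Defined.

Definition is_zero V : Prop := forall n (x : V n), x = 0.

(* H_0(V)_i = V_i / \sum_(j < i) C(j, i) V_j *)
Definition H0 V (i : nat) : lmodType k :=
  quotM (submod_span (fun x : V i =>
    exists j (f : inj j i) (y : V j), (j < i)%N /\ x = cm_act V f y)).

Definition is_gd V (g : \bar int) : Prop :=
  match g with
  | d%:E => exists i : nat, [/\ d = i%:Z, nonzero (H0 V i) &
              forall j, nonzero (H0 V j) -> (j <= i)%N]
  | -oo => forall i, ~ nonzero (H0 V i)
  | +oo => forall i, exists2 j, (i <= j)%N & nonzero (H0 V j)
  end%E.

Definition gd V : \bar int := xget +oo%E [set g | is_gd V g]%classic.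

Lemma is_gd_uniq V g g' : is_gd V g -> is_gd V g' -> g = g'.
Proof.
case: g g' => [d||] [d'||] //=.
- move=> [i [-> Hi mi]] [j [-> Hj mj]]; congr (_%:Z%:E)%E.
  by apply/eqP; rewrite eqn_leq mi // mj.
- by move=> [i [_ _ mi]] /(_ i.+1)[j ij /mi]; rewrite leqNgt ij.
- by move=> [i [_ Hi _]] /(_ i).
- by move=> H [i [_ _ mi]]; have [j ij /mi] := H i.+1; rewrite leqNgt ij.
- by move=> /(_ 0)[j _ Hj] /(_ j).
- by move=> H [i [_ /H]].
- by move=> H /(_ 0)[j _ /H].
Qed.

Lemma gdP V : is_gd V (gd V).
Proof.
suff [g Hg] : exists g, is_gd V g by apply: (@xgetPex _ _ [set g | is_gd V g]%classic); exists g.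
have [H|/existsNP[i0 /contrapT H0i]] := pselect (forall i, ~ nonzero (H0 V i)).
  by exists -oo%E.
have [H|/existsNP[N HN]] :=
  pselect (forall i, exists2 j, (i <= j)%N & nonzero (H0 V j)).
  by exists +oo%E.
have ub j : `[< nonzero (H0 V j) >] -> (j <= N)%N.
  by move=> /asboolP Hj; case: (leqP j N) => // /ltnW Nj; case: HN; exists j.
have ex : exists j, `[< nonzero (H0 V j) >] by exists i0; apply/asboolP.
case: (ex_maxnP ex ub) => j /asboolP Hj mj; exists (j%:Z%:E)%E, j; split=> // l Hl.
exact/mj/asboolP.
Qed.

End Constructions.

Section Induced.
Variables (k : comPzRingType) (i : nat) (T : lmodType k).

(* {ffun inj i m -> T} is the direct sum of copies of T indexed by C(i, m),
   i.e. C_(i, m) (x)_k T, where C_(i, m) is the free k-module on C(i, m);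
   for T = k it is C_(i, m) itself. *)
Definition tens_pure m (a : inj i m) (t : T) : {ffun inj i m -> T} :=
  [ffun b => if b == a then t else 0].

Definition push m n (f : inj m n) (u : {ffun inj i m -> T}) :
    {ffun inj i n -> T} :=
  [ffun b => \sum_(a | injM f a == b) u a].

Fact push_linear m n (f : inj m n) : linear (push f).
Proof.
move=> c u v; apply/ffunP => b; rewrite !ffunE scaler_sumr -big_split.
by apply: eq_bigr => a _; rewrite !ffunE.
Qed.
HB.instance Definition _ m n (f : inj m n) :=
  GRing.isLinear.Build k {ffun inj i m -> T} {ffun inj i n -> T} *:%R
    (push f) (@push_linear m n f).

Lemma tens_sum m (u : {ffun inj i m -> T}) : u = \sum_a tens_pure a (u a).
Proof.
apply/ffunP => b; rewrite sum_ffunE (bigD1 b) //= ffunE eqxx big1 ?addr0 //.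
by move=> a /negPf; rewrite ffunE eq_sym => ->.
Qed.

Lemma push_tens m n (f : inj m n) a t : push f (tens_pure a t) = tens_pure (injM f a) t.
Proof.
apply/ffunP => b; rewrite !ffunE; case: eqVneq => [->|ba].
  rewrite (bigD1 a) //= ffunE eqxx big1 ?addr0 // => c /andP[_ /negPf ca].
  by rewrite ffunE ca.
rewrite big1 // => c /eqP cb; rewrite ffunE; case: eqVneq => // ca.
by rewrite -cb ca eqxx in ba.
Qed.

Fact push1 n u : push (inj1 n) u = u.
Proof.
rewrite [u]tens_sum linear_sum; apply: eq_bigr => a _.
by rewrite /= push_tens injM1.
Qed.

Fact pushM m n p (g : inj n p) (f : inj m n) u :
  push (injM g f) u = push g (push f u).
Proof.
rewrite [u]tens_sum !linear_sum; apply: eq_bigr => a _.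
by rewrite /= !push_tens injMA.
Qed.

Definition cm_ind : cmodule k :=
  @Cmodule k (fun n => {ffun inj i n -> T}) (fun m n f => push f) push1 pushM.
End Induced.

Definition cm_free (k : comPzRingType) (i : nat) : cmodule k := cm_ind i k^o.

Definition fin_gen (k : comPzRingType) (V : cmodule k) : Prop :=
  exists (s : seq nat) (p : cmor (foldr (@cm_sum k) (cm_zero k)
                                    [seq cm_free k i | i <- s]) V),
    forall n (y : V n), exists x, p n x = y.

Definition torsion (k : comPzRingType) (V : cmodule k) : Prop :=
  fin_gen V /\ exists N, forall i, (N <= i)%N -> forall x : V i, x = 0.

(* A kS_i-module, where S_i = C(i, i): a k-module with a k-linear left action
   of S_i. *)
Record kSmodule (k : comPzRingType) (i : nat) := KSmodule {
  ks_obj :> lmodType k;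
  ks_act : inj i i -> {linear ks_obj -> ks_obj};
  ks_act1 : forall t, ks_act (inj1 i) t = t;
  ks_actM : forall s s' t, ks_act (injM s s') t = ks_act s (ks_act s' t) }.

Section Basic.
Variables (k : comPzRingType) (i : nat) (T : kSmodule k i).

(* The relations (a \o s) (x) t = a (x) (s t) making the tensor product over k
   into the tensor product over kS_i. *)
Definition tens_rel m : submod {ffun inj i m -> T} :=
  submod_span (fun u => exists (a : inj i m) (s : inj i i) (t : T),
    u = tens_pure (injM a s) t - tens_pure a (ks_act T s t)).

Fact tens_rel_act m n (f : inj m n) (u : cm_ind i T m) :
  u \in submod_pred (tens_rel m) ->
  cm_act (cm_ind i T) f u \in submod_pred (tens_rel n).
Proof.
apply: (submod_span_le (S := preim_submod (cm_act (cm_ind i T) f) (tens_rel n))).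
move=> _ [a [s [t ->]]].
rewrite -[_ \in _]/(push f _ \in submod_pred (tens_rel n)) linearB /= !push_tens.
by apply: mem_submod_span; exists (injM f a), s, t; rewrite injMA.
Qed.

Definition basic : cmodule k :=
  cm_quot (@Submodule k (cm_ind i T) tens_rel tens_rel_act).

Lemma basic_universal m (M : lmodType k) (b : inj i m -> {linear T -> M}) :
  (forall a s t, b (injM a s) t = b a (ks_act T s t)) ->
  exists h : {linear basic m -> M},
    (forall a t, h (quot_pi (tens_rel m) (tens_pure a t)) = b a t) /\
    forall g : {linear basic m -> M},
      (forall a t, g (quot_pi (tens_rel m) (tens_pure a t)) = b a t) -> g =1 h.
Proof.
move=> bal; pose h0 (u : {ffun inj i m -> T}) := \sum_a b a (u a).
have h0L : linear h0.
  move=> c u v; rewrite scaler_sumr -big_split; apply: eq_bigr => a _.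
  by rewrite !ffunE linearP.
pose h0l : {linear {ffun inj i m -> T} -> M} :=
  HB.pack h0 (GRing.isLinear.Build _ _ _ _ h0 h0L).
have h0E a t : h0 (tens_pure a t) = b a t.
  rewrite /h0 (bigD1 a) //= ffunE eqxx big1 ?addr0 // => c /negPf ca.
  by rewrite ffunE ca linear0.
have h0S u : u \in submod_pred (tens_rel m) -> h0 u = 0.
  have /[apply] := @submod_span_le _ _ _ (ker_submod h0l) _ u.
  move=> H; apply/eqP; rewrite -[_ == _]/(u \in submod_pred (ker_submod h0l)).
  apply: H => _ [a [s [t ->]]]; rewrite inE linearB /= !h0E bal.
  by rewrite subrr.
pose h (x : basic m) := h0 (quot_repr x).
have hE u : h (quot_pi _ u) = h0 u.
  apply/eqP; rewrite -subr_eq0 -[_ - _](linearB h0l); apply/eqP/h0S.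
  by apply/quot_piE; rewrite quot_reprK.
have hL : linear h.
  move=> c x y; rewrite -[x]quot_reprK -[y]quot_reprK -linearP !hE.
  exact: h0L.
pose hl : {linear basic m -> M} := HB.pack h (GRing.isLinear.Build _ _ _ _ h hL).
exists hl; split=> [a t|g gE]; first by rewrite /= hE h0E.
move=> x; rewrite -[x]quot_reprK [quot_repr x]tens_sum !linear_sum.
by apply: eq_bigr => a _; rewrite /= gE hE h0E.
Qed.
End Basic.

(* W 0, ..., W s are the terms V^(-1), ..., V^r of the filtration, r = s - 1. *)
Definition sharp_filtered (k : comPzRingType) (V : cmodule k) : Prop :=
  fin_gen V /\ exists (s : nat) (W : nat -> submodule V),
    [/\ forall n x, x \in submod_pred (W 0 n) -> x = 0,
        forall n x, x \in submod_pred (W s n) &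
        forall j, (j < s)%N ->
          (forall n, {subset submod_pred (W j n) <= submod_pred (W j.+1 n)}) /\
          exists (i : nat) (T : kSmodule k i),
            cm_iso (cm_subquot (W j.+1) (W j)) (basic T)].

(* The complex 0 -> V -> F 0 -> F 1 -> ..., shifted so that its leftmost term 0
   is at index 0, V at index 1 and F i at index i.+2. *)
Definition coaug (k : comPzRingType) (V : cmodule k) (F : nat -> cmodule k)
    (i : nat) : cmodule k :=
  match i with
  | 0 => cm_zero k
  | 1 => V
  | i.+2 => F i
  end.

(* Main.v *)
Require Import Defs.
From HB Require Import structures.
From mathcomp Require Import all_boot all_order all_algebra perm.
From mathcomp Require Import boolp classical_sets constructive_ereal.

(* Write V_(<g) for the submodule generated in degrees < g.  The kernels of the
   maps V_g -> (S^d V)_g / ((S^d V)_(<g))_g increase with d, so they are constant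
   from some D on because V_g is a noetherian k-module.  If V is generated in
   degrees <= g, then for W = S^D V the quotient W / W_(<g) is the basic module
   on T = (W / W_(<g))_g: given a relation \sum_a a t_a = 0 in degree n, shift so
   that the image of one fixed b becomes the part not created by the shift; every
   a whose image differs from that of b then factors through a lower degree, and
   stability forces \sum_s s t_(b s) = 0 in T, which is the relation holding in
   the tensor product over kS_g.  Induction on g applied to W_(<g) shows that S^d V
   is #-filtered for large d, since #-filtered modules are closed under extensions
   and shifts.
   The cokernel of V -> S^d V is generated in degrees one lower than V, and
   iterating V |-> coker (V -> S^d V) gives the complex.  A #-filtered module is
   torsion free, so V -> S^d V is injective in large degrees; hence the homology
   vanishes in large degrees, and it is finitely generated because it is
   degreewise noetherian. *)

Set Implicit Arguments.
Unset Strict Implicit.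
Unset Printing Implicit Defensive.

Import GRing.Theory.
Local Open Scope ring_scope.

(** * Noetherian modules *)

Section Noetherian.
Variable k : comPzRingType.
Implicit Types M N : lmodType k.

Lemma im_submodP M N (f : {linear M -> N}) y :
  y \in submod_pred (im_submod f) <-> exists x, y = f x.
Proof. exact: (iff_sym (rwP (asboolP _))). Qed.

Lemma preim_submodE M N (f : {linear M -> N}) (S : submod N) x :
  (x \in submod_pred (preim_submod f S)) = (f x \in submod_pred S).
Proof. by []. Qed.

Definition seq_span M (s : seq M) : submod M := submod_span (fun x => x \in s).

Definition fg_module M : Prop :=
  exists s : seq M, forall x, x \in submod_pred (seq_span s).

Definition noetherian_module M : Prop :=
  forall S : submod M, exists s : seq M,
    forall x, x \in submod_pred S <-> x \in submod_pred (seq_span s).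

Lemma seq_span_sub M (s t : seq M) x :
  {subset s <= t} -> x \in submod_pred (seq_span s) -> x \in submod_pred (seq_span t).
Proof. by move=> st; apply: submod_span_le => y /st; apply: mem_submod_span. Qed.

Lemma seq_span_lin M N (f : {linear M -> N}) (s : seq M) x :
  x \in submod_pred (seq_span s) -> f x \in submod_pred (seq_span (map f s)).
Proof.
apply: (submod_span_le (S := preim_submod f (seq_span (map f s)))) => y ys.
exact/mem_submod_span/map_f.
Qed.

Lemma seq_span_map M N (f : {linear M -> N}) (s : seq M) y :
  y \in submod_pred (seq_span (map f s)) ->
  exists2 x, x \in submod_pred (seq_span s) & y = f x.
Proof.
pose g : {linear subM (seq_span s) -> N} := f \o (val : {linear subM (seq_span s) -> M}).
move=> ys; suff /im_submodP[x ->] : y \in submod_pred (im_submod g).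
  by exists (val x) => //; exact: valP.
move: y ys; apply: submod_span_le => _ /mapP[x xs ->]; apply/asboolP.
by exists (Sub x (mem_submod_span xs)).
Qed.

Definition scalel M (x : M) (c : k^o) : M := c *: x.
Fact scalel_linear M (x : M) : linear (scalel x).
Proof. by move=> a b c; rewrite /scalel scalerDl scalerA. Qed.
HB.instance Definition _ M (x : M) :=
  GRing.isLinear.Build k k^o M *:%R (scalel x) (@scalel_linear M x).

Lemma quot_pi0 M (S : submod M) x : quot_pi S x = 0 <-> x \in submod_pred S.
Proof. by rewrite -[x in x \in _]subr0 -quot_piE linear0. Qed.

Lemma quot_pi_eq0 M (S : submod M) x : x \in submod_pred S -> quot_pi S x = 0.
Proof. by move=> /quot_pi0. Qed.

Lemma seq_span_cons M (x : M) s y :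
  y \in submod_pred (seq_span (x :: s)) ->
  exists c z, z \in submod_pred (seq_span s) /\ y = c *: x + z.
Proof.
pose S := seq_span s; pose f : {linear k^o -> quotM S} := quot_pi S \o scalel x.
move=> ys; have : y \in submod_pred (preim_submod (quot_pi S) (im_submod f)).
  move: y ys; apply: submod_span_le => z; rewrite inE => /predU1P[->|zs]; apply/asboolP.
    by exists 1; rewrite /f /= /scalel scale1r.
  by exists 0; rewrite linear0; apply/quot_pi0/mem_submod_span.
move=> /asboolP[c /quot_piE yc]; exists c, (y - c *: x); split=> //.
by rewrite addrC subrK.
Qed.

(** Lifts to [S] of generators [s] of the image of [S], together with generators [t] of the kernel
    of [f] on [S], generate [S]. Injective [f] is the case of empty [t]. *)
Lemma seq_span_cat_lin M N (f : {linear M -> N}) (S : submod M) (s : seq N) (t : seq M) :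
    (forall x, x \in submod_pred S -> f x \in submod_pred (seq_span s)) ->
    (forall y, y \in s -> exists2 x, x \in submod_pred S & y = f x) ->
    (forall x, x \in submod_pred S -> f x = 0 -> x \in submod_pred (seq_span t)) ->
    {subset t <= submod_pred S} ->
  exists s' : seq M, forall x, x \in submod_pred S <-> x \in submod_pred (seq_span s').
Proof.
move=> fS sS S0 tS.
have [s' s'S s'E] : exists2 s', {subset s' <= submod_pred S} & map f s' = s.
  elim: s {fS} sS => [|y s IHs] sS; first by exists [::].
  have [z|s' s'S s'E] := IHs; first by move=> zs; apply: sS; rewrite inE zs orbT.
  have [x xS yE] := sS y (mem_head _ _).
  exists (x :: s'); last by rewrite /= -yE s'E.
  by move=> z; rewrite inE => /predU1P[->|/s'S].
have catS : forall x, x \in submod_pred (seq_span (s' ++ t)) -> x \in submod_pred S.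
  by apply: submod_span_le => z; rewrite mem_cat => /orP[/s'S|/tS].
exists (s' ++ t) => x; split=> [xS|]; last exact: catS.
have := fS x xS; rewrite -s'E => /seq_span_map[z zs' fxz].
have zc : z \in submod_pred (seq_span (s' ++ t)).
  by apply: seq_span_sub zs' => w ws; rewrite mem_cat ws.
rewrite -[x](subrK z) rpredD //.
apply: (@seq_span_sub _ t) => [w wt|]; first by rewrite mem_cat wt orbT.
by apply: S0; rewrite ?linearB ?fxz ?subrr // rpredB // catS.
Qed.

Fact cap_closed M (S S' : submod M) :
  submod_closed [pred x | (x \in submod_pred S) && (x \in submod_pred S')].
Proof.
split=> [|a x y /andP[xS xS'] /andP[yS yS']]; rewrite inE ?rpred0 //.
by rewrite !rpredD ?rpredZ.
Qed.
Definition cap_submod M (S S' : submod M) : submod M := Submod (@cap_closed M S S').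

(** Induction on the number of generators. Modulo the remaining generators [S] becomes a submodule
    of a cyclic module, whose preimage in [k] is a finitely generated ideal; the part of [S] in
    their span is covered by induction. *)
Lemma fg_noetherian M : noetherian k -> fg_module M -> noetherian_module M.
Proof.
move=> kN [s sM] S.
(* The induction concerns submodules of the fixed [M] lying in the span of a list, so that the spans
   need not be turned into modules themselves. *)
suff: forall (s : seq M) (S : submod M),
    (forall x, x \in submod_pred S -> x \in submod_pred (seq_span s)) ->
  exists s' : seq M, forall x, x \in submod_pred S <-> x \in submod_pred (seq_span s').
  by move=> /(_ s S); apply=> x _; exact: sM.
move=> {s sM S}; elim=> [|x s IHs] S Ss.
  by exists [::] => x; split=> [/Ss//|]; apply: submod_span_le.
pose pi : {linear M -> quotM (seq_span s)} := quot_pi (seq_span s).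
pose piS : {linear subM S -> _} := pi \o (val : {linear subM S -> M}).
pose pix : {linear k^o -> _} := pi \o scalel x.
have [r rE] := kN (preim_submod pix (im_submod piS)).
have [t tE] := IHs (cap_submod S (seq_span s)) (fun y yS => proj2 (andP yS)).
apply: (@seq_span_cat_lin _ _ pi S (map pix r) t).
- move=> y yS; have [c [z [zs yE]]] := seq_span_cons (Ss y yS).
  have yx : pi y = pix c by rewrite yE linearD /= (quot_pi_eq0 zs) addr0.
  rewrite yx; apply: seq_span_lin; rewrite /seq_span -rE; apply/im_submodP.
  by exists (Sub y yS); rewrite -yx.
- move=> _ /mapP[c cr ->].
  have : c \in submod_pred (preim_submod pix (im_submod piS)).
    by rewrite rE; apply: mem_submod_span.
  by move=> /im_submodP[y ->]; exists (val y) => //; exact: valP.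
- by move=> y yS /quot_pi0 ys; apply/tE; rewrite inE yS.
- move=> y yt; have /tE/andP[//] : y \in submod_pred (seq_span t).
  exact: mem_submod_span.
Qed.

Lemma noetherian_fg M : noetherian_module M -> fg_module M.
Proof.
move=> /(_ (ker_submod (\0 : {linear M -> M}))) [s sE]; exists s => x.
by apply/sE; rewrite inE.
Qed.

Lemma noetherian_inj M N (f : {linear M -> N}) :
  injective f -> noetherian_module N -> noetherian_module M.
Proof.
move=> fI NN S; pose f' : {linear subM S -> N} := f \o (val : {linear subM S -> M}).
have [s sE] := NN (im_submod f').
apply: (@seq_span_cat_lin _ _ f S s [::]) => //.
- by move=> x xS; apply/sE/asboolP; exists (Sub x xS).
- move=> y ys; have /im_submodP[x ->] : y \in submod_pred (im_submod f').
    exact/sE/mem_submod_span.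
  by exists (val x) => //; exact: valP.
- by move=> x _ fx0; rewrite (fI x 0) ?linear0 // rpred0.
Qed.

Lemma noetherian_surj M N (f : {linear M -> N}) :
  (forall y, exists x, f x = y) -> noetherian_module M -> noetherian_module N.
Proof.
move=> fS MN S; have [s sE] := MN (preim_submod f S).
exists (map f s) => y; split=> [yS|].
  by have [x xy] := fS y; rewrite -xy; apply/seq_span_lin/sE; rewrite inE xy.
by move=> /seq_span_map[x /sE]; rewrite inE => ? ->.
Qed.

Lemma fg_surj M N (f : {linear M -> N}) :
  (forall y, exists x, f x = y) -> fg_module M -> fg_module N.
Proof.
move=> fS [s sM]; exists (map f s) => y.
by have [x <-] := fS y; apply: seq_span_lin.
Qed.

Lemma noetherian_chain M (K : nat -> submod M) : noetherian_module M ->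
    (forall d, {subset submod_pred (K d) <= submod_pred (K d.+1)}) ->
  exists D, forall d, {subset submod_pred (K d) <= submod_pred (K D)}.
Proof.
move=> MN K1.
have KS d e : (d <= e)%N -> {subset submod_pred (K d) <= submod_pred (K e)}.
  by move=> /subnK<-; elim: (e - d)%N => // c IHc x /IHc/K1.
have UC : submod_closed [pred x | `[< exists d, x \in submod_pred (K d) >]].
  split=> [|a x y /asboolP[d xd] /asboolP[e ye]]; apply/asboolP.
    by exists 0; exact: rpred0.
  exists (maxn d e); rewrite rpredD ?rpredZ //.
    exact: KS (leq_maxl _ _) _ xd.
  exact: KS (leq_maxr _ _) _ ye.
have [s sE] := MN (Submod UC).
have sK : forall x, x \in s -> exists d, x \in submod_pred (K d).
  by move=> x xs; apply/asboolP/(sE x)/mem_submod_span.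
have [D sD] : exists D, forall x, x \in s -> x \in submod_pred (K D).
  elim: (s) sK => [|x t IHt] tK; first by exists 0.
  have [y yt|D tD] := IHt; first by apply: tK; rewrite inE yt orbT.
  have [d xd] := tK x (mem_head _ _); exists (maxn d D) => y.
  rewrite inE => /predU1P[->|/tD]; first exact: KS (leq_maxl _ _) _ xd.
  exact: KS (leq_maxr _ _) _.
exists D => d x xd; apply: (submod_span_le (P := fun x => x \in s)) => //.
by apply/sE/asboolP; exists d.
Qed.
End Noetherian.

(** * Injections *)

Section Injections.

Lemma big_inj_reindex (R : nmodType) (I J : finType) (h : J -> I) (P : pred I)
    (F : I -> R) :
    injective h -> (forall i, P i <-> exists j, i = h j) ->
  \sum_(i | P i) F i = \sum_j F (h j).
Proof.
move=> hI PE; rewrite -(big_imset _ (in2W hI)); apply: eq_bigl => i.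
by apply/idP/imsetP => [/PE[j ->]|[j _ ->]]; [exists j | apply/PE; exists j].
Qed.

Lemma inj1M m n (f : inj m n) : injM f (inj1 m) = f.
Proof. by apply: inj_eqP => x; rewrite injME mk_injE. Qed.

Lemma injM_injr m n p (g : inj n p) : injective (fun f : inj m n => injM g f).
Proof.
move=> f f' ff'; apply: inj_eqP => x; apply: (@inj_inj _ _ g).
by rewrite -!injME ff'.
Qed.

Lemma inj_size_leq m n (f : inj m n) : (m <= n)%N.
Proof. by have := leq_card f (@inj_inj _ _ f); rewrite !card_ord. Qed.

Lemma inj_bij n (s : inj n n) : bijective s.
Proof. exact/injF_bij/inj_inj. Qed.

Lemma inj_inv n (s : inj n n) :
  exists s' : inj n n, injM s s' = inj1 n /\ injM s' s = inj1 n.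
Proof.
have [h sK hK] := inj_bij s; exists (mk_inj (can_inj hK)).
by split; apply: inj_eqP => x; rewrite injME !mk_injE ?sK ?hK.
Qed.

Lemma injM_injl n m (s : inj n n) : injective (fun f : inj n m => injM f s).
Proof.
move=> f f' ff'; have [s' [ss' _]] := inj_inv s.
by rewrite -[f]inj1M -[f']inj1M -ss' -!injMA ff'.
Qed.

(** It misses exactly the point that [inj_iota] adjoins. By [inj_lift_iota] it is natural, which
    yields the map from a module to its shift. *)
Definition inj_lift n : inj n n.+1 := mk_inj (@lift_inj n.+1 ord0).

Lemma inj_liftE n x : inj_lift n x = lift ord0 x. Proof. exact: mk_injE. Qed.

Lemma inj_lift_iota m n (f : inj m n) :
  injM (inj_iota f) (inj_lift m) = injM (inj_lift n) f.
Proof. by apply: inj_eqP => x; rewrite !injME !inj_liftE inj_iotaS. Qed.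

Lemma inj_iota_inj m n : injective (@inj_iota m n).
Proof.
move=> f g fg; apply: inj_eqP => x; apply: (@lift_inj _ ord0).
by rewrite -!inj_iotaS fg.
Qed.

Lemma inj_avoid0 m n (f : inj m n.+1) :
  (forall x, f x != ord0) <-> exists g, f = injM (inj_lift n) g.
Proof.
split=> [f0|[g ->] x]; last by rewrite injME inj_liftE.
have f0' x : ord0 != f x by rewrite eq_sym.
pose g x := s2val (unlift_some (f0' x)).
have gE x : f x = lift ord0 (g x) by rewrite /g; case: unlift_some.
have gI : injective g.
  by move=> x y gxy; apply: (@inj_inj _ _ f); rewrite !gE gxy.
by exists (mk_inj gI); apply: inj_eqP => x; rewrite injME inj_liftE mk_injE.
Qed.

Lemma inj_fix0 m n (f : inj m.+1 n.+1) :
  f ord0 = ord0 <-> exists g, f = inj_iota g.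
Proof.
split=> [f0|[g ->]]; last exact: inj_iota0.
have [x|g gE] := (inj_avoid0 (injM f (inj_lift m))).1.
  by rewrite injME inj_liftE -[X in _ != X]f0 (inj_eq (@inj_inj _ _ f)) eq_sym neq_lift.
exists g; apply: inj_eqP => x.
case: (unliftP ord0 x) => [y|] ->; last by rewrite inj_iota0.
by rewrite inj_iotaS -inj_liftE -injME gE injME inj_liftE.
Qed.

Lemma inj_swap0 n (x : 'I_n.+1) :
  exists s : inj n.+1 n.+1, s x = ord0 /\ s ord0 = x.
Proof.
exists (mk_inj (can_inj (tpermK x ord0))).
by rewrite !mk_injE tpermL tpermR.
Qed.

Lemma inj_split_hit n j (f : inj j.+1 n.+1) x : f x = ord0 ->
  exists (g : inj j n) s, f = injM (inj_iota g) s.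
Proof.
move=> fx; have [s [sx s0]] := inj_swap0 x; have [s' [ss' s's]] := inj_inv s.
have [|g gE] := (inj_fix0 (injM f s)).1; first by rewrite injME s0.
by exists g, s'; rewrite -gE injMA ss' inj1M.
Qed.
(** An injection into [n.+1] points either misses 0 or is an [inj_iota] up to a permutation of its
    source. The source size is an index because the second case forces it to be positive. *)
Variant inj_split_spec n : forall j, inj j n.+1 -> Prop :=
| InjAvoid0 j (g : inj j n) : inj_split_spec (injM (inj_lift n) g)
| InjHit0 j (g : inj j n) (s : inj j.+1 j.+1) :
    inj_split_spec (injM (inj_iota g) s).

Lemma inj_splitP n j (f : inj j n.+1) : inj_split_spec f.
Proof.
have [x /eqP fx|f0] := pickP (fun x => f x == ord0); last first.
  by have [x|g ->] := (inj_avoid0 f).1; [rewrite f0 | exact: InjAvoid0].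
case: j f x fx => [|j] f x fx; first by case: x {fx}.
by have [g [s ->]] := inj_split_hit fx; exact: InjHit0.
Qed.

End Injections.

(** * Morphisms, shifts and generation *)

Section Morphisms.
Variable k : comPzRingType.
Implicit Types U V W Q : cmodule k.

Definition cmor_id V : cmor V V := @Cmor k V V (fun n => idfun) (fun _ _ _ _ => erefl).

Fact cmor_comp_nat U V W (g : cmor V W) (f : cmor U V) m n (a : inj m n) x :
  (g n \o f n) (cm_act U a x) = cm_act W a ((g m \o f m) x).
Proof. by rewrite /= !cmor_nat. Qed.
Definition cmor_comp U V W (g : cmor V W) (f : cmor U V) : cmor U W :=
  @Cmor k U W (fun n => g n \o f n) (cmor_comp_nat g f).

Fact cmor_zero_nat U V m n (a : inj m n) x :
  (\0 : {linear U n -> V n}) (cm_act U a x) = cm_act V a ((\0 : {linear U m -> V m}) x).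
Proof. by rewrite /= linear0. Qed.
Definition cmor_zero U V : cmor U V := @Cmor k U V (fun n => \0) (@cmor_zero_nat U V).

Definition cm_val V (W : submodule V) : cmor (cm_sub W) V :=
  @Cmor k (cm_sub W) V (fun n => val : {linear subM (W n) -> V n})
    (fun _ _ _ _ => erefl).

Fact cm_pi_nat V (W : submodule V) m n (a : inj m n) x :
  quot_pi (W n) (cm_act V a x) = cm_act (cm_quot W) a (quot_pi (W m) x).
Proof. by rewrite /= quot_map_pi. Qed.
Definition cm_pi V (W : submodule V) : cmor V (cm_quot W) :=
  @Cmor k V (cm_quot W) (fun n => quot_pi (W n)) (@cm_pi_nat V W).

Definition cm_inj U V (f : cmor U V) := forall n, injective (f n).
Definition cm_surj U V (f : cmor U V) := forall n y, exists x, f n x = y.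
Definition cm_exact U V W (f : cmor U V) (g : cmor V W) :=
  forall n x, g n x = 0 <-> exists y, x = f n y.

Definition ses U V W := exists (f : cmor U V) (g : cmor V W),
  [/\ cm_inj f, cm_exact f g & cm_surj g].

Lemma cm_pi_surj V (W : submodule V) : cm_surj (cm_pi W).
Proof. by move=> n y; exists (quot_repr y); exact: quot_reprK. Qed.

Lemma cm_val_inj V (W : submodule V) : cm_inj (cm_val W).
Proof. by move=> n; exact: val_inj. Qed.

Lemma cm_inj0 U V (f : cmor U V) : (forall n x, f n x = 0 -> x = 0) -> cm_inj f.
Proof.
move=> f0 n x y fxy; apply/eqP; rewrite -subr_eq0; apply/eqP/f0.
by rewrite linearB fxy subrr.
Qed.

Lemma cmor_lift U V W (f : cmor U W) (g : cmor V W) :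
    cm_inj g -> (forall n x, exists y, f n x = g n y) ->
  exists h : cmor U V, forall n x, g n (h n x) = f n x.
Proof.
move=> gI fg; pose h n x := sval (cid (fg n x)).
have hE n x : g n (h n x) = f n x by rewrite /h; case: cid.
have hL n : linear (h n).
  by move=> a x y; apply: (gI n); rewrite linearP !hE linearP.
pose hl n : {linear U n -> V n} :=
  HB.pack (h n) (GRing.isLinear.Build _ _ _ _ (h n) (hL n)).
have hN m n (a : inj m n) x : hl n (cm_act U a x) = cm_act V a (hl m x).
  by apply: (gI n); rewrite cmor_nat /= !hE cmor_nat.
by exists (Cmor hN).
Qed.

Lemma cmor_factor U V W (p : cmor U V) (f : cmor U W) :
    cm_surj p -> (forall n x, p n x = 0 -> f n x = 0) ->
  exists h : cmor V W, forall n x, h n (p n x) = f n x.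
Proof.
move=> pS pf; pose h n x := f n (sval (cid (pS n x))).
have hE n x : h n (p n x) = f n x.
  rewrite /h; case: cid => y /= yE; apply/eqP; rewrite -subr_eq0 -linearB.
  by rewrite pf // linearB yE subrr.
have hL n : linear (h n).
  move=> a x y; have [x' <-] := pS n x; have [y' <-] := pS n y.
  by rewrite -linearP !hE linearP.
pose hl n : {linear V n -> W n} :=
  HB.pack (h n) (GRing.isLinear.Build _ _ _ _ (h n) (hL n)).
have hN m n (a : inj m n) x : hl n (cm_act V a x) = cm_act W a (hl m x).
  by have [y <-] := pS m x; rewrite -cmor_nat /= !hE cmor_nat.
by exists (Cmor hN).
Qed.

Lemma cm_iso_image U V W (f : cmor U W) (g : cmor V W) :
    cm_inj f -> cm_inj g ->
    (forall n x, exists y, f n x = g n y) -> (forall n y, exists x, g n y = f n x) ->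
  cm_iso U V.
Proof.
move=> fI gI fg gf; have [h hE] := cmor_lift gI fg; have [h' h'E] := cmor_lift fI gf.
exists h, h'; split=> n x; first by apply: (fI n); rewrite h'E hE.
by apply: (gI n); rewrite hE h'E.
Qed.

Lemma cm_iso_bij U V (f : cmor U V) : cm_inj f -> cm_surj f -> cm_iso U V.
Proof.
move=> fI fS; apply: (@cm_iso_image U V V f (cmor_id V)) => // [n x y //|n x|n x].
  by exists (f n x).
by have [y <-] := fS n x; exists y.
Qed.

Lemma cm_iso_sym U V : cm_iso U V -> cm_iso V U.
Proof. by case=> f [g [fK gK]]; exists g, f. Qed.

Lemma cm_iso_ind U V : cm_iso U V -> exists f : cmor U V, cm_inj f /\ cm_surj f.
Proof.
case=> f [g [fK gK]]; exists f; split=> n; first exact: can_inj (fK n).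
by move=> y; exists (g n y); exact: gK.
Qed.

Lemma ses_quot V (W : submodule V) : ses (cm_sub W) V (cm_quot W).
Proof.
exists (cm_val W), (cm_pi W); split; [exact: cm_val_inj | | exact: cm_pi_surj].
move=> n x; split=> [/quot_pi0 xW|[y ->]]; last exact/quot_pi_eq0/valP.
by exists (Sub x xW).
Qed.

Lemma ses_im U V (f : cmor U V) : cm_inj f -> ses U V (cm_quot (cm_im f)).
Proof.
move=> fI; exists f, (cm_pi (cm_im f)); split=> //; last exact: cm_pi_surj.
by move=> n x; split=> [/quot_pi0/im_submodP//|/im_submodP]; exact: quot_pi_eq0.
Qed.

Lemma ses_coker U V W (f : cmor U V) (g : cmor V W) :
  cm_exact f g -> cm_surj g -> cm_iso W (cm_quot (cm_im f)).
Proof.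
move=> fg gS.
have [n x /quot_pi0/im_submodP/fg//|h hE] :=
  cmor_factor (p := cm_pi (cm_im f)) (f := g) (@cm_pi_surj _ _).
apply/cm_iso_sym/(cm_iso_bij (f := h)).
  apply: cm_inj0 => n x; have [y <-] := cm_pi_surj (W := cm_im f) x.
  rewrite hE => /fg/im_submodP.
  exact: quot_pi_eq0.
by move=> n y; have [x <-] := gS n y; exists (cm_pi (cm_im f) n x).
Qed.

Fact shift_mor_nat U V (f : cmor U V) m n (a : inj m n) x :
  f n.+1 (cm_act (cm_shift U) a x) = cm_act (cm_shift V) a (f m.+1 x).
Proof. exact: cmor_nat. Qed.
Definition shift_mor U V (f : cmor U V) : cmor (cm_shift U) (cm_shift V) :=
  @Cmor k (cm_shift U) (cm_shift V) (fun n => f n.+1) (@shift_mor_nat U V f).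

Lemma ses_shift U V W : ses U V W -> ses (cm_shift U) (cm_shift V) (cm_shift W).
Proof.
move=> [f [g [fI fg gS]]]; exists (shift_mor f), (shift_mor g).
by split=> [n|n x|n y]; [exact: (fI n.+1) | exact: (fg n.+1) | exact: (gS n.+1)].
Qed.

Fact iota_mor_nat V m n (a : inj m n) x :
  cm_act V (inj_lift n) (cm_act V a x) = cm_act (cm_shift V) a (cm_act V (inj_lift m) x).
Proof. by rewrite /= -!cm_actM inj_lift_iota. Qed.
Definition shift_unit V : cmor V (cm_shift V) :=
  @Cmor k V (cm_shift V) (fun n => cm_act V (inj_lift n)) (@iota_mor_nat V).

Fixpoint shift_incl V d : cmor V (iter d (@cm_shift k) V) :=
  if d is e.+1 then cmor_comp (shift_unit _) (shift_incl V e) else cmor_id V.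

Lemma cm_sub_act V N m n (a : inj m n) (x : V m) :
  x \in submod_pred (submod_span (fun x : V m =>
    exists j (f : inj j m) (y : V j), (j < N)%N /\ x = cm_act V f y)) ->
  cm_act V a x \in submod_pred (submod_span (fun x : V n =>
    exists j (f : inj j n) (y : V j), (j < N)%N /\ x = cm_act V f y)).
Proof.
apply: (submod_span_le (S := preim_submod (cm_act V a) (submod_span _))).
move=> _ [j [f [y [jN ->]]]]; apply: mem_submod_span.
by exists j, (injM a f), y; rewrite cm_actM.
Qed.

(** In degree [N] the quotient by it is [H0 V N] by conversion, so lying in [lt_sub V N N] means
    vanishing in H_0. *)
Definition lt_sub V N : submodule V := Submodule (@cm_sub_act V N).

(** The bound is strict, so that [N = 0] is the zero module and the truncated predecessor lowers the
    bound correctly. *)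
Definition gen_lt V N := forall n x, x \in submod_pred (lt_sub V N n).

Lemma lt_sub_act V N j n (f : inj j n) (y : V j) :
  (j < N)%N -> cm_act V f y \in submod_pred (lt_sub V N n).
Proof. by move=> jN; apply: mem_submod_span; exists j, f, y. Qed.

Lemma lt_sub_low V N j (y : V j) : (j < N)%N -> y \in submod_pred (lt_sub V N j).
Proof. by move=> jN; rewrite -(cm_act1 y) lt_sub_act. Qed.

Lemma lt_sub_min V N n (S : submod (V n)) :
  (forall j (f : inj j n) (y : V j), (j < N)%N -> cm_act V f y \in submod_pred S) ->
  forall x, x \in submod_pred (lt_sub V N n) -> x \in submod_pred S.
Proof. by move=> NS; apply: submod_span_le => _ [j [f [y [jN ->]]]]; exact: NS. Qed.

Lemma lt_sub_mono V N N' n : (N <= N')%N ->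
  {subset submod_pred (lt_sub V N n) <= submod_pred (lt_sub V N' n)}.
Proof.
move=> NN'; apply: lt_sub_min => j f y jN; exact/lt_sub_act/(leq_trans jN).
Qed.

Lemma gen_lt_leq V N N' : (N <= N')%N -> gen_lt V N -> gen_lt V N'.
Proof. by move=> NN' VN n x; exact/(lt_sub_mono NN')/VN. Qed.

Lemma lt_sub_mor U V (f : cmor U V) N n x :
  x \in submod_pred (lt_sub U N n) -> f n x \in submod_pred (lt_sub V N n).
Proof.
apply: (lt_sub_min (S := preim_submod (f n) (lt_sub V N n))) => j a y jN.
rewrite preim_submodE cmor_nat; exact: lt_sub_act.
Qed.

Lemma gen_lt_surj U V (f : cmor U V) N : cm_surj f -> gen_lt U N -> gen_lt V N.
Proof. by move=> fS UN n y; have [x <-] := fS n y; apply/lt_sub_mor/UN. Qed.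

Lemma gen_lt0 V : gen_lt V 0 <-> is_zero V.
Proof.
split=> [V0 n x|V0 n x]; last by rewrite (V0 n x) rpred0.
by apply/eqP; have := V0 n x; apply: (lt_sub_min (S := ker_submod idfun)).
Qed.

Lemma gen_lt_sub V N : gen_lt (cm_sub (lt_sub V N)) N.
Proof.
move=> n x; pose S := lt_sub (cm_sub (lt_sub V N)) N n.
pose f : {linear subM S -> V n} := (val : {linear subM (lt_sub V N n) -> V n})
  \o (val : {linear subM S -> subM (lt_sub V N n)}).
have : val x \in submod_pred (im_submod f).
  apply: (lt_sub_min (S := im_submod f) _ (valP x)) => j a y jN; apply/im_submodP.
  pose y' : cm_sub (lt_sub V N) j := Sub y (lt_sub_low y jN).
  by exists (Sub (cm_act (cm_sub (lt_sub V N)) a y') (lt_sub_act a y' jN)).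
by move=> /im_submodP[y /val_inj->]; exact: valP.
Qed.

(** An injection missing 0 acts through the unit followed by an action on the shift, from the same
    degree; one hitting 0 acts on the shift from one degree lower. *)
Lemma lt_sub_shift V N n (x : V n.+1) :
  x \in submod_pred (lt_sub V N n.+1) -> x \in submod_pred (lt_sub (cm_shift V) N n).
Proof.
move: x; apply: (lt_sub_min (V := V) (S := lt_sub (cm_shift V) N n)) => j f.
case: j f / (inj_splitP f) => [j g|j g s] y jN.
  have -> : cm_act V (injM (inj_lift n) g) y =
            cm_act (cm_shift V) g (cm_act V (inj_lift j) y).
    by rewrite /= -!cm_actM inj_lift_iota.
  exact: lt_sub_act.
rewrite cm_actM; apply: (lt_sub_act (V := cm_shift V)); exact: ltnW.
Qed.

(** Removing the point sent to 0 leaves a source with one point fewer. This drop is what lowers the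
    generating degree of the cokernels. *)
Lemma lt_sub_shift_hit V N n j (f : inj j n.+1) (y : V j) x :
  (j < N)%N -> f x = ord0 -> cm_act V f y \in submod_pred (lt_sub (cm_shift V) N.-1 n).
Proof.
case: j f y x => [|j] f y x jN; first by case: x.
move=> /inj_split_hit[g [s ->]]; rewrite cm_actM.
by apply: (lt_sub_act (V := cm_shift V)); case: N jN.
Qed.

Lemma gen_lt_shift V N : gen_lt V N -> gen_lt (cm_shift V) N.
Proof. by move=> VN n x; exact/lt_sub_shift/VN. Qed.

Lemma gen_lt_iter V N d : gen_lt V N -> gen_lt (iter d (@cm_shift k) V) N.
Proof. by move=> VN; elim: d => //= d; exact: gen_lt_shift. Qed.

(** Injections missing 0 contribute elements coming from [V]; those hitting 0 contribute elements
    generated one degree lower. *)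
Lemma shift_unit_gen V N n (x : V n.+1) : gen_lt V N ->
  exists y, x - shift_unit V n y \in submod_pred (lt_sub (cm_shift V) N.-1 n).
Proof.
move=> /(_ _ x) xN; set S := lt_sub (cm_shift V) N.-1 n.
pose f : {linear V n -> quotM S} := quot_pi S \o shift_unit V n.
suff : x \in submod_pred (preim_submod (quot_pi S : {linear V n.+1 -> _}) (im_submod f)).
  by move=> /im_submodP[y /quot_piE]; exists y.
move: x xN; apply: lt_sub_min => j a y jN; apply/im_submodP.
have [x /eqP ax|a0] := pickP (fun x => a x == ord0).
  exists 0; rewrite linear0; apply: quot_pi_eq0.
  exact: (lt_sub_shift_hit _ jN ax).
have [x|g ->] := (inj_avoid0 a).1; first by rewrite a0.
by exists (cm_act V g y); rewrite cm_actM.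
Qed.

Lemma shift_incl_gen V N d n (x : iter d (@cm_shift k) V n) : gen_lt V N ->
  exists y, x - shift_incl V d n y \in
    submod_pred (lt_sub (iter d (@cm_shift k) V) N.-1 n).
Proof.
move=> VN; elim: d x => [|d IHd] x; first by exists x; rewrite [_ - _]subrr rpred0.
have [y xy] := shift_unit_gen x (gen_lt_iter (d := d) VN).
have [z yz] := IHd y; exists z.
have -> : x - shift_incl V d.+1 n z =
    (x - shift_unit _ n y) + shift_unit _ n (y - shift_incl V d n z).
  by rewrite linearB addrA subrK.
by rewrite rpredD //; exact: lt_sub_mor yz.
Qed.

(** The image of [V] absorbs the generators of top degree. Iterated, this bounds the length of the
    complex. *)
Lemma shift_coker_gen V N d :
  gen_lt V N -> gen_lt (cm_quot (cm_im (shift_incl V d))) N.-1.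
Proof.
move=> VN n x; rewrite -[x]quot_reprK; set y := quot_repr x.
have [z yz] := shift_incl_gen y VN.
have -> : quot_pi (cm_im (shift_incl V d) n) y =
    cm_pi (cm_im (shift_incl V d)) n (y - shift_incl V d n z).
  by apply/quot_piE; rewrite opprB addrC subrK; apply/im_submodP; exists z.
exact: lt_sub_mor yz.
Qed.
End Morphisms.

(** * Iterated extensions of basic modules *)

Section SharpFiltered.
Variable k : comPzRingType.
Implicit Types U V W Q : cmodule k.

(* Being #-filtered apart from finite generation, phrased with short exact
   sequences so that it transports along isomorphisms. *)
Inductive iter_ext V : Prop :=
| IterExtZero of is_zero V
| IterExtStep U i (T : kSmodule k i) of iter_ext U & ses U V (basic T).

Lemma cm_val_kerP V W (g : cmor V W) n (x : V n) :
  g n x = 0 -> exists y : cm_sub (cm_ker g) n, cm_val (cm_ker g) n y = x.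
Proof.
move=> gx; have xK : x \in submod_pred (cm_ker g n) by rewrite inE gx.
by exists (Sub x xK).
Qed.

Lemma ses_isom U V V' W : ses U V W -> cm_iso V V' -> ses U V' W.
Proof.
move=> [f [g [fI fg gS]]] [h [h' [hK h'K]]]; exists (cmor_comp h f), (cmor_comp g h'); split.
- by move=> n x y /= /(can_inj (hK n))/fI.
- move=> n x /=; rewrite fg; split=> [[y yE]|[y ->]]; exists y; last by rewrite hK.
  by rewrite -yE h'K.
- by move=> n y; have [x <-] := gS n y; exists (h n x); rewrite /= hK.
Qed.

Lemma iter_ext_iso V V' : cm_iso V V' -> iter_ext V -> iter_ext V'.
Proof.
move=> VV'; case=> [V0|U i T SU]; last by move=> /ses_isom/(_ VV'); exact: IterExtStep.
have [f [_ fS]] := cm_iso_ind VV'.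
by apply: IterExtZero => n x; have [y <-] := fS n x; rewrite (V0 _ y) linear0.
Qed.

(** Induction on [Q]. If [Q] is an extension of [basic T] by [Q'], then the kernel of the composite
    [gg] from [V] to [basic T] is an extension of [Q'] by [U], to which the induction hypothesis
    applies. *)
Lemma iter_ext_ses U V Q : iter_ext U -> iter_ext Q -> ses U V Q -> iter_ext V.
Proof.
move=> SU SQ.
elim: SQ V => {Q} [Q Q0|Q Q' i T SQ' IH [f' [g' [f'I fg' gS']]]] V
  [f [g [fI fg gS]]].
  apply: iter_ext_iso SU; apply: (cm_iso_bij (f := f)) => // n x.
  by have /fg[y ->] : g n x = 0; [exact: Q0 | exists y].
pose gg := cmor_comp g' g; pose v := cm_val (cm_ker gg).
have vI : cm_inj v := @cm_val_inj _ _ _.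
have v0 n x : gg n (v n x) = 0 by apply/eqP; exact: (valP x).
have [|u uE] := @cmor_lift _ U (cm_sub (cm_ker gg)) V f v vI.
  move=> n x; have [|y yE] := @cm_val_kerP _ _ gg n (f n x); last by exists y.
  by rewrite /= (_ : g n (f n x) = 0) ?linear0 //; apply/fg; exists x.
have [|p pE] := @cmor_lift _ (cm_sub (cm_ker gg)) Q' Q (cmor_comp g v) f' f'I.
  by move=> n x; apply/fg'; exact: v0.
apply: (IterExtStep (U := cm_sub (cm_ker gg)) (T := T)).
  apply: IH; exists u, p; split.
  - by move=> n x y uxy; apply: (fI n); rewrite -!uE uxy.
  - move=> n x; split=> [px|[y ->]].
      have /fg[y yE] : g n (v n x) = 0 by have := pE n x; rewrite px linear0.
      by exists y; apply: (vI n); rewrite uE.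
    by apply: (f'I n); rewrite pE linear0; apply/fg; exists y; exact: uE.
  - move=> n y; have [z zE] := gS n (f' n y).
    have [|x xE] := @cm_val_kerP _ _ gg n z.
      by rewrite /= zE; apply/fg'; exists y.
    by exists x; apply: (f'I n); rewrite pE -zE -xE.
exists v, gg; split=> //.
- move=> n x; split=> [/cm_val_kerP[y <-]|[y ->]]; [by exists y | exact: v0].
- by move=> n y; have [z <-] := gS' n y; have [x <-] := gS n z; exists x.
Qed.

Lemma iter_ext_basic i (T : kSmodule k i) : iter_ext (basic T).
Proof.
have zU : iter_ext (cm_zero k) by apply: IterExtZero => n x; exact: thinmx0.
apply: (IterExtStep (T := T) zU).
exists (cmor_zero (cm_zero k) (basic T)), (cmor_id (basic T)); split=> [n x y _|n x|n y].
- by rewrite [x]thinmx0 [y]thinmx0.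
- by split=> [/= ->|[y ->]] //; exists 0.
- by exists y.
Qed.

(** The bound is kept because iterated extensions are torsion free in all degrees, but the cokernels
    in the complex only in large degrees. *)
Definition torsion_free_from V N := forall n m (f : inj n m),
  (N <= n)%N -> injective (cm_act V f).

Lemma torsion_free_ses U V Q : ses U V Q ->
  torsion_free_from U 0 -> torsion_free_from Q 0 -> torsion_free_from V 0.
Proof.
move=> [f [g [fI fg gS]]] Ut Qt n m a _ x y axy.
apply/eqP; rewrite -subr_eq0; apply/eqP; set z := x - y.
have az : cm_act V a z = 0 by rewrite linearB axy subrr.
have gz : g n z = 0.
  by apply: (Qt _ _ a isT); rewrite -cmor_nat az !linear0.
move/fg: gz => [w zE]; rewrite zE (_ : w = 0) ?linear0 //.
apply: (Ut _ _ a isT); apply: (fI m); by rewrite cmor_nat -zE az !linear0.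
Qed.

Section TensPure.
Variables (i : nat) (T : lmodType k).
Fact tens_pure_linear m (a : inj i m) : linear (@tens_pure k i T m a).
Proof.
by move=> c u v; apply/ffunP => b; rewrite !ffunE; case: eqP; rewrite // scaler0 addr0.
Qed.
HB.instance Definition _ m a := GRing.isLinear.Build k T {ffun inj i m -> T} *:%R
  (@tens_pure k i T m a) (@tens_pure_linear m a).
End TensPure.

(** * Basic modules and the norm map *)

Section Basic.
Variables (i : nat) (T : kSmodule k i).

(* S_i acts freely on C(i, m), so the norm of the S_i-action embeds the tensor
   product over kS_i into the functions C(i, m) -> T; orbit_sum is that norm. *)
Definition orbit_sum m (b : inj i m) (u : {ffun inj i m -> T}) : T :=
  \sum_s ks_act T s (u (injM b s)).

Fact orbit_sum_linear m b : linear (@orbit_sum m b).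
Proof.
move=> c u v; rewrite /orbit_sum scaler_sumr -big_split; apply: eq_bigr => s _.
by rewrite !ffunE linearP.
Qed.
HB.instance Definition _ m b := GRing.isLinear.Build k {ffun inj i m -> T} T *:%R
  (@orbit_sum m b) (@orbit_sum_linear m b).

Lemma basic_pi_act m (a : inj i m) s t :
  quot_pi (tens_rel T m) (tens_pure (injM a s) t) =
  quot_pi (tens_rel T m) (tens_pure a (ks_act T s t)).
Proof. by apply/quot_piE/mem_submod_span; exists a, s, t. Qed.

Lemma basic_pi_pure m (P : pred (inj i m)) (c : inj i m) (u : {ffun inj i m -> T}) :
    (forall a, P a <-> exists s, a = injM c s) ->
  quot_pi (tens_rel T m) (\sum_(a | P a) tens_pure a (u a)) =
  quot_pi (tens_rel T m) (tens_pure c (orbit_sum c u)).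
Proof.
move=> PE; rewrite (big_inj_reindex (h := injM c) _ (@injM_injr _ _ _ c) PE).
rewrite linear_sum /orbit_sum !linear_sum; apply: eq_bigr => s _; exact: basic_pi_act.
Qed.

(** The norm kills the relations by reindexing over S_i. Conversely, [u] splits over the S_i-orbits
    in C(i, m), and on the orbit of [c] it is congruent to the pure tensor of [c] with
    [orbit_sum c u]. *)
Lemma tens_relP m (u : {ffun inj i m -> T}) :
  u \in submod_pred (tens_rel T m) <-> forall b, orbit_sum b u = 0.
Proof.
split=> [uT b|u0].
  suff : u \in submod_pred (ker_submod (orbit_sum b)) by rewrite inE => /eqP.
  move: u uT; apply: submod_span_le => _ [a [s [t ->]]].
  rewrite inE linearB subr_eq0 /= /orbit_sum; apply/eqP.
  rewrite [LHS](reindex_inj (@injM_injl _ _ s)); apply: eq_bigr => s' _.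
  rewrite !ffunE -injMA (inj_eq (@injM_injl _ _ s)).
  by case: eqP; rewrite ?linear0 // ks_actM.
apply/quot_pi0; rewrite [u]tens_sum.
pose orb (a : inj i m) : pred (inj i m) := fun c => [exists s : inj i i, a == injM c s].
(* A canonical orbit representative: [choose] depends only on the extension of the predicate, which
   is constant along the orbit. *)
pose rep a := choose (orb a) a.
have orb_refl a : orb a a by apply/existsP; exists (inj1 i); rewrite inj1M.
have orb_eq c s : orb (injM c s) =1 orb c.
  move=> d; apply/existsP/existsP => -[s1 /eqP E].
    have [s' [ss' _]] := inj_inv s; exists (injM s1 s').
    by rewrite -injMA -E injMA ss' inj1M.
  by exists (injM s1 s); rewrite -injMA -E.
have rep_eq c s : rep (injM c s) = rep c.
  rewrite /rep (eq_choose (orb_eq c s)); apply: choose_id => //.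
  by rewrite -(orb_eq c s).
rewrite (partition_big rep predT) //= linear_sum big1 // => c _.
have [a /eqP ac|none] := pickP (fun a => rep a == c); last by rewrite big_pred0 ?linear0.
have /existsP[s /eqP as_] : orb a c by rewrite -ac; exact: chooseP.
suff E b : rep b == c <-> exists s, b = injM c s.
  by apply: (etrans (basic_pi_pure u E)); rewrite u0 !linear0.
split=> [/eqP bc|[s' ->]].
  by have /existsP[s' /eqP] : orb b c; [rewrite -bc; exact: chooseP | exists s'].
by rewrite rep_eq -(rep_eq c s) -as_ ac.
Qed.

Lemma push_orbit_sum m n (f : inj m n) (b : inj i m) (u : {ffun inj i m -> T}) :
  orbit_sum (injM f b) (push f u) = orbit_sum b u.
Proof.
apply: eq_bigr => s _; rewrite ffunE injMA (big_pred1 (injM b s)) // => a.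
exact: (inj_eq (@injM_injr _ _ _ f)).
Qed.

(** The orbit sums detect zero in the tensor product, and each orbit sum at [b] reappears at
    [injM f b] after pushing along [f]. *)
Lemma basic_torsion_free : torsion_free_from (basic T) 0.
Proof.
move=> n m f _ x y fxy; apply/eqP; rewrite -subr_eq0; apply/eqP.
have : cm_act (basic T) f (x - y) = 0 by rewrite linearB fxy subrr.
rewrite -[x - y]quot_reprK; move: (quot_repr _) => u.
rewrite [cm_act _ _ _]quot_map_pi => /quot_pi0/tens_relP fu.
by apply/quot_pi0/tens_relP => b; rewrite -(push_orbit_sum f); exact: fu.
Qed.
End Basic.

Lemma iter_ext_torsion_free V : iter_ext V -> torsion_free_from V 0.
Proof.
elim=> {}V => [V0 n m f _ x y _|U i T _ Ut /torsion_free_ses].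
  by rewrite [x]V0 [y]V0.
by apply=> //; exact: basic_torsion_free.
Qed.

Section InducedMap.
Variables (i : nat) (T : lmodType k) (Q : cmodule k) (phi : {linear T -> Q i}).

Definition ind_map_at n (u : cm_ind i T n) : Q n := \sum_a cm_act Q a (phi (u a)).

Fact ind_map_linear n : linear (@ind_map_at n).
Proof.
move=> c u v; rewrite /ind_map_at scaler_sumr -big_split; apply: eq_bigr => s _.
by rewrite !ffunE !linearP.
Qed.
HB.instance Definition _ n := GRing.isLinear.Build k (cm_ind i T n) (Q n) *:%R
  (@ind_map_at n) (@ind_map_linear n).

Lemma ind_map_tens n (a : inj i n) t :
  ind_map_at (tens_pure a t : cm_ind i T n) = cm_act Q a (phi t).
Proof.
rewrite /ind_map_at (bigD1 a) //= ffunE eqxx big1 ?addr0 // => b /negPf ba.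
by rewrite ffunE ba !linear0.
Qed.

Fact ind_map_nat m n (f : inj m n) (u : cm_ind i T m) :
  ind_map_at (cm_act (cm_ind i T) f u) = cm_act Q f (ind_map_at u).
Proof.
rewrite [u]tens_sum (linear_sum (cm_act (cm_ind i T) f)) (linear_sum (@ind_map_at n)).
rewrite (linear_sum (@ind_map_at m)) (linear_sum (cm_act Q f)); apply: eq_bigr => a _ /=.
by rewrite push_tens !ind_map_tens cm_actM.
Qed.
Definition ind_map : cmor (cm_ind i T) Q :=
  @Cmor k (cm_ind i T) Q (fun n => @ind_map_at n) ind_map_nat.
End InducedMap.

(** Recognizes a basic module. By [tens_relP] the last hypothesis says that the kernel of the
    induced map lies in the relations of the tensor product over kS_i. *)
Lemma basic_iso i (T : kSmodule k i) Q (phi : {linear T -> Q i}) :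
    (forall s t, phi (ks_act T s t) = cm_act Q s (phi t)) ->
    cm_surj (ind_map phi) ->
    (forall n u, ind_map phi n u = 0 -> forall b, orbit_sum b u = 0) ->
  cm_iso Q (basic T).
Proof.
move=> phiE phiS phi0.
pose p : cmor (cm_ind i T) (basic T) := cm_pi (Submodule (@tens_rel_act k i T)).
have pS : cm_surj p := @cm_pi_surj _ _ _.
have [|h hE] := @cmor_factor _ _ _ _ p (ind_map phi) pS.
  move=> n x /quot_pi0 xT; apply/eqP.
  suff : x \in submod_pred (ker_submod (ind_map phi n)) by [].
  move: x xT; apply: submod_span_le => _ [a [s [t ->]]].
  by rewrite inE linearB /= !ind_map_tens cm_actM phiE subrr.
apply/cm_iso_sym/(cm_iso_bij (f := h)).
  apply: cm_inj0 => n x; have [u <-] := pS n x; rewrite hE => /phi0 u0.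
  exact/quot_pi_eq0/tens_relP.
by move=> n y; have [u <-] := phiS n y; exists (p n u).
Qed.
End SharpFiltered.

(** * Shifts of basic modules *)

Section ShiftBasic.
Variable k : comPzRingType.
Implicit Types U V W Q : cmodule k.

(** Restriction to S_i embedded in S_(i+1) as the stabilizer of the point 0. *)
Definition ks_restrict i (T : kSmodule k i.+1) : kSmodule k i.
Proof.
exists T (fun s => ks_act T (inj_iota s)).
- by move=> t; rewrite inj_iota_id ks_act1.
- by move=> s s' t; rewrite inj_iota_comp ks_actM.
Defined.

Lemma basic_tens_act i (T : kSmodule k i) m n (f : inj m n) a t :
  cm_act (basic T) f (quot_pi (tens_rel T m) (tens_pure a t)) =
  quot_pi (tens_rel T n) (tens_pure (injM f a) t).
Proof. by rewrite [cm_act _ _ _]quot_map_pi [cm_act _ _ _]push_tens. Qed.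

Lemma basic_ind i (T : kSmodule k i) n (S : submod (basic T n)) :
  (forall a t, quot_pi (tens_rel T n) (tens_pure a t) \in submod_pred S) ->
  forall x, x \in submod_pred S.
Proof.
move=> aS x; rewrite -[x]quot_reprK [quot_repr x]tens_sum linear_sum.
by apply: rpred_sum => a _; exact: aS.
Qed.

(** The classes of the identity tensored with [t]: they sit in degree [i] of the shift and generate
    the cokernel. *)
Definition basic_cogen i (T : kSmodule k i.+1) (t : T) :
    cm_quot (cm_im (shift_unit (basic T))) i :=
  cm_pi (cm_im (shift_unit (basic T))) i
    (quot_pi (tens_rel T i.+1) (tens_pure (inj1 i.+1) t)).

Fact basic_cogen_linear i (T : kSmodule k i.+1) : linear (@basic_cogen i T).
Proof. by move=> c x y; rewrite /basic_cogen !linearP. Qed.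
HB.instance Definition _ i (T : kSmodule k i.+1) := GRing.isLinear.Build k T
  (cm_quot (cm_im (shift_unit (basic T))) i) *:%R (@basic_cogen i T)
  (@basic_cogen_linear i T).

Lemma act_basic_cogen i (T : kSmodule k i.+1) n (a : inj i n) t :
  cm_act (cm_quot (cm_im (shift_unit (basic T)))) a (basic_cogen t) =
  cm_pi (cm_im (shift_unit (basic T))) n
    (quot_pi (tens_rel T n.+1) (tens_pure (inj_iota a) t)).
Proof.
rewrite /basic_cogen -cmor_nat; congr (cm_pi _ n _).
by rewrite [cm_act _ _ _]basic_tens_act inj1M.
Qed.

(** Tensors on injections missing 0 form the image of the unit. An injection hitting 0 is
    [inj_iota g] times a permutation, and [inj_iota] leaves only the stabilizer of 0 acting. *)
Lemma shift_basic_coker i (T : kSmodule k i.+1) :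
  cm_iso (cm_quot (cm_im (shift_unit (basic T)))) (basic (ks_restrict T)).
Proof.
set B := basic T; set Q := cm_quot _; set pi := cm_pi (cm_im (shift_unit B)).
apply: (@basic_iso k i (ks_restrict T) Q (@basic_cogen i T : {linear _ -> _})).
- move=> s t; rewrite act_basic_cogen /basic_cogen -[inj_iota s]injM1.
  by rewrite basic_pi_act.
- move=> n x; have [y <-] := cm_pi_surj x.
  pose pi' : {linear B n.+1 -> Q n} := pi n.
  suff /im_submodP[z] : y \in submod_pred (preim_submod pi'
      (im_submod (ind_map (@basic_cogen i T) n))).
    by exists z.
  move: y; apply: basic_ind => a t; apply/im_submodP.
  have [/existsP[x0 /eqP ax]|/existsPn a0] := boolP [exists x, a x == ord0].
    have [g [s ->]] := inj_split_hit ax.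
    exists (tens_pure g (ks_act T s t)); rewrite [RHS]ind_map_tens act_basic_cogen.
    by rewrite basic_pi_act.
  have [//|g ->] := (inj_avoid0 a).1.
  exists 0; rewrite linear0; apply/quot_pi0/im_submodP.
  by exists (quot_pi (tens_rel T n) (tens_pure g t)); rewrite [RHS]basic_tens_act.
move=> n u u0 b.
(* A representative in [B n.+1] of the image of [u] in the cokernel, supported on injections that
   fix 0. *)
pose w := \sum_a tens_pure (inj_iota a) (u a) : {ffun inj i.+1 n.+1 -> T}.
have : pi n (quot_pi (tens_rel T n.+1) w) = 0.
  rewrite -u0 /w !linear_sum; apply: eq_bigr => a _; exact/esym/act_basic_cogen.
move=> /quot_pi0/im_submodP[v]; rewrite -[v]quot_reprK; move: (quot_repr v) => {}v.
rewrite [RHS]quot_map_pi => /quot_piE/tens_relP/(_ (inj_iota b)).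
rewrite linearB /=.
have w_iota a : w (inj_iota a) = u a.
  rewrite sum_ffunE (bigD1 a) //= ffunE eqxx big1 ?addr0 // => c ca.
  by rewrite ffunE (inj_eq (@inj_iota_inj _ _)) eq_sym (negPf ca).
have w_out (a : inj i.+1 n.+1) : a ord0 != ord0 -> w a = 0.
  move=> a0; rewrite sum_ffunE big1 // => c _; rewrite ffunE.
  by case: (a =P _) a0 => [->|//]; rewrite inj_iota0 eqxx.
(* The pushed element is supported on injections missing 0, while [injM (inj_iota b) s] always hits
   0. *)
have -> : orbit_sum (inj_iota b) (push (inj_lift n) v) = 0.
  rewrite /orbit_sum big1 // => s _; rewrite ffunE big_pred0 ?linear0 // => a.
  apply/eqP => E; have [x xE] : exists x, (s : inj _ _) x = ord0.
    by have [h _ hK] := inj_bij s; exists (h ord0).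
  have := congr1 (fun f : inj _ _ => f x) E.
  by rewrite !injME xE inj_iota0 inj_liftE => /eqP; rewrite eq_sym (negPf (neq_lift _ _)).
rewrite subr0 => <-; rewrite /orbit_sum.
(* Only permutations fixing 0 contribute, and they are the images of S_i under [inj_iota]. *)
rewrite [RHS](bigID (fun s : inj i.+1 i.+1 => s ord0 == ord0)) /=.
rewrite [X in _ + X]big1 ?addr0; last first.
  move=> s s0; rewrite w_out ?linear0 // injME -[X in _ != X](inj_iota0 b).
  by rewrite (inj_eq (@inj_inj _ _ _)).
rewrite (big_inj_reindex (h := @inj_iota i i)) => [|//|s]; last first.
- by rewrite -inj_fix0; split=> [/eqP|->].
- exact: inj_iota_inj.
by apply: eq_bigr => s _; rewrite -inj_iota_comp w_iota.
Qed.

Lemma shift_basic_coker0 (T : kSmodule k 0) :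
  is_zero (cm_quot (cm_im (shift_unit (basic T)))).
Proof.
move=> n x; have [y <-] := cm_pi_surj x; apply/quot_pi0.
move: y; apply: basic_ind => a t; have [[]//|g ->] := (inj_avoid0 a).1.
apply/im_submodP; exists (quot_pi (tens_rel T n) (tens_pure g t)).
by rewrite [RHS]basic_tens_act.
Qed.

(** By torsion freeness the basic module embeds in its shift, and the cokernel is basic, or zero
    when [i = 0]. *)
Lemma iter_ext_shift_basic i (T : kSmodule k i) : iter_ext (cm_shift (basic T)).
Proof.
have uI : cm_inj (shift_unit (basic T)).
  by move=> n; exact: basic_torsion_free.
apply: (iter_ext_ses (iter_ext_basic T) _ (ses_im uI)).
case: i T {uI} => [|i] T; first exact/IterExtZero/shift_basic_coker0.
apply: iter_ext_iso (iter_ext_basic (ks_restrict T)).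
exact/cm_iso_sym/shift_basic_coker.
Qed.

Lemma iter_ext_shift V : iter_ext V -> iter_ext (cm_shift V).
Proof.
elim=> {}V => [V0|U i T _ SU /ses_shift]; first by apply: IterExtZero => n; exact: V0.
by apply: iter_ext_ses => //; exact: iter_ext_shift_basic.
Qed.

Lemma iter_ext_iter V d : iter_ext V -> iter_ext (iter d (@cm_shift k) V).
Proof. by move=> SV; elim: d => //= d; exact: iter_ext_shift. Qed.
End ShiftBasic.

(** * The shift theorem *)

Section ShiftTheorem.
Variable k : comPzRingType.
Implicit Types U V W Q : cmodule k.
Notation shift := (@cm_shift k).

(* V_g / (V_(<g))_g -> (S V)_g / ((S V)_(<g))_g is injective. *)
Definition stable1 g V := forall y : V g,
  shift_unit V g y \in submod_pred (lt_sub (cm_shift V) g g) ->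
  y \in submod_pred (lt_sub V g g).

Definition stable g V := forall e, stable1 g (iter e shift V).

Lemma stable_shift g V : stable g V -> stable g (cm_shift V).
Proof. by move=> gV e; rewrite -iterSr; exact: (gV e.+1). Qed.

Lemma lt_sub_perm V N n (s : inj n n) x :
  cm_act V s x \in submod_pred (lt_sub V N n) -> x \in submod_pred (lt_sub V N n).
Proof.
have [s' [_ s's]] := inj_inv s.
by move=> /(sm_act s'); rewrite -cm_actM s's cm_act1.
Qed.

Lemma inj_miss0 m n (b : inj m n.+1) : (m < n.+1)%N ->
  exists s : inj n.+1 n.+1, forall x, s (b x) != ord0.
Proof.
move=> mn; have [x xb] : exists x, x \notin codom b.
  apply/existsP; apply: contraLR mn; rewrite negb_exists -leqNgt => /forallP nb.
  have /subset_leq_card : 'I_n.+1 \subset codom b.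
    by apply/fintype.subsetP => x _; rewrite -[_ \in _]negbK nb.
  by rewrite (card_codom (@inj_inj _ _ b)) !card_ord.
have [s [sx s0]] := inj_swap0 x; exists s => y; apply: contra xb => /eqP sby.
by rewrite (_ : x = b y) ?codom_f //; apply: (@inj_inj _ _ s); rewrite sx sby.
Qed.

(** The base case of the relation argument: in degree [g] every injection is a permutation, so
    acting by [b] turns the conclusion into the hypothesis. *)
Lemma lt_sub_independent g V (u : inj g g -> V g) :
    \sum_a cm_act V a (u a) \in submod_pred (lt_sub V g g) ->
  forall b, \sum_s cm_act V s (u (injM b s)) \in submod_pred (lt_sub V g g).
Proof.
move=> uV b; apply: (lt_sub_perm (s := b)).
rewrite linear_sum (reindex_inj (@injM_injr _ _ _ b)) in uV *.
by under eq_bigr do rewrite -cm_actM.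
Qed.

Lemma stable_independent g n V (u : inj g n -> V g) : stable g V ->
    \sum_a cm_act V a (u a) \in submod_pred (lt_sub V g n) ->
  forall b, \sum_s cm_act V s (u (injM b s)) \in submod_pred (lt_sub V g g).
Proof.
elim: n V u => [|n IHn] V u gV uV b; move: (inj_size_leq b);
  rewrite leq_eqVlt => /orP[/eqP g0|gn] //; try by subst g; exact: lt_sub_independent.
(* The terms of the relation whose injection hits 0 come from degrees < g of the
   shift of V, so the others form a relation in the shift, one degree lower. *)
have [t tb] := inj_miss0 b gn; have [t' [tt' t't]] := inj_inv t.
have [|b' bE] := (inj_avoid0 (injM t b)).1; first by move=> x; rewrite injME tb.
(* [t] moves a point missed by [b] to 0, so [injM t b] descends to [b']. The family [u'] is the
   relation acted on by [t] and restricted to the injections that miss 0. *)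
pose u' (a : inj g n) := shift_unit V g (u (injM t' (injM (inj_lift n) a))).
have := IHn (cm_shift V) u' (stable_shift gV) _ b'.
have -> : \sum_s cm_act (cm_shift V) s (u' (injM b' s)) =
    shift_unit V g (\sum_s cm_act V s (u (injM b s))).
  rewrite linear_sum; apply: eq_bigr => s _; rewrite /u' -cmor_nat.
  by rewrite -(injMA _ b') -bE -!injMA t't injM1.
(* Stability of [V] itself brings the conclusion back from the shift. *)
move=> IH; apply: (gV 0); apply: IH => {b b' bE tb gn}.
have : cm_act V t (\sum_a cm_act V a (u a)) \in submod_pred (lt_sub (cm_shift V) g n).
  exact/lt_sub_shift/sm_act.
rewrite linear_sum (reindex_inj (@injM_injr _ _ _ t')).
under eq_bigr do rewrite -cm_actM -injMA tt' injM1.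
rewrite (bigID (fun a : inj g n.+1 => [exists x, a x == ord0])) rpredDl.
  rewrite (big_inj_reindex (h := injM (inj_lift n))); first 1 last.
  - exact: injM_injr.
  - move=> a; rewrite -inj_avoid0; split=> [/existsPn//|a0]; exact/existsPn.
  under eq_bigr do
    rewrite cm_actM [cm_act V (inj_lift n) _](cmor_nat (shift_unit V)).
  by [].
apply: rpred_sum => a /existsP[x /eqP ax].
(* The bound [g.+1] admits a source of size [g], and its predecessor is the required [g]. *)
exact: (@lt_sub_shift_hit _ _ g.+1 _ _ _ _ x).
Qed.

Definition ks_at V g : kSmodule k g :=
  KSmodule (ks_obj := V g) (fun t => @cm_act1 k V g t)
    (fun s s' t => @cm_actM k V g g g s s' t).

(** Generation in degrees at most [g] makes the quotient generated in degree [g]; stability leaves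
    only the relations of the tensor product over kS_g. *)
Lemma stable_top g V : stable g V -> gen_lt V g.+1 ->
  cm_iso (cm_quot (lt_sub V g)) (basic (ks_at (cm_quot (lt_sub V g)) g)).
Proof.
move=> gV VN; set Q := cm_quot _; set pi := cm_pi (lt_sub V g).
apply: (@basic_iso k g (ks_at Q g) Q (idfun : {linear Q g -> Q g})) => //.
- move=> n x; have [y <-] := cm_pi_surj x.
  pose pi' : {linear V n -> Q n} := pi n.
  suff /im_submodP[z] : y \in submod_pred (preim_submod pi'
      (im_submod (ind_map (idfun : {linear Q g -> Q g}) n))) by exists z.
  apply: lt_sub_min (VN n y) => j a z; rewrite ltnS leq_eqVlt => /orP[/eqP jg|jg].
    subst j; apply/im_submodP; exists (tens_pure a (pi g z)).
    by rewrite [RHS]ind_map_tens; exact: (cmor_nat pi).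
  apply/im_submodP; exists 0; rewrite linear0; apply: quot_pi_eq0; exact: lt_sub_act.
move=> n u u0 b.
(* Lifting the coefficients to [V] turns the relation in the quotient into membership in V_(<g). *)
pose v a : V g := quot_repr (u a).
have vE a : pi g (v a) = u a by exact: quot_reprK.
have : \sum_a cm_act V a (v a) \in submod_pred (lt_sub V g n).
  apply/quot_pi0; rewrite -[RHS]u0 linear_sum; apply: eq_bigr => a _.
  by rewrite [LHS](cmor_nat pi) vE.
move=> /(stable_independent gV)/(_ b)/quot_pi0 <-; rewrite linear_sum.
by apply: eq_bigr => s _; rewrite [LHS](cmor_nat pi) vE.
Qed.

Definition loc_noetherian V := forall n, noetherian_module (V n).

Lemma loc_noetherian_iter V d : loc_noetherian V -> loc_noetherian (iter d shift V).
Proof. by move=> VN; elim: d => //= d IHd n; exact: IHd. Qed.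

Lemma loc_noetherian_inj U V (f : cmor U V) :
  cm_inj f -> loc_noetherian V -> loc_noetherian U.
Proof. by move=> fI VN n; exact: noetherian_inj (fI n) (VN n). Qed.

Lemma loc_noetherian_surj U V (f : cmor U V) :
  cm_surj f -> loc_noetherian U -> loc_noetherian V.
Proof. by move=> fS VN n; exact: noetherian_surj (fS n) (VN n). Qed.

Lemma shift_stable g V : gen_lt V g.+1 -> loc_noetherian V ->
  exists D, stable g (iter D shift V).
Proof.
move=> VN Vn.
(* The kernel of the map from [V g] to H_0 in degree [g] of the [d]-fold shift. *)
pose K d := preim_submod (shift_incl V d g) (lt_sub (iter d shift V) g g).
have K1 d : {subset submod_pred (K d) <= submod_pred (K d.+1)}.
  by move=> x; rewrite /K !preim_submodE; exact: lt_sub_mor.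
have [D KD] := noetherian_chain (Vn g) K1; exists D => e; rewrite -iterD.
have KDe : {subset submod_pred (K (e + D).+1) <= submod_pred (K (e + D)%N)}.
  move=> x /KD; elim: e => //= e IHe xD; exact/K1/IHe.
move: (e + D)%N KDe => d Kd y yd.
(* Up to terms from degrees below [g], every element of the shift in degree [g] comes from [V], so
   stability reduces to the chain [K] being constant. *)
have [x xy] := shift_incl_gen y VN.
rewrite -[y](subrK (shift_incl V d g x)) rpredD //; apply: (Kd x).
rewrite /K preim_submodE.
have -> : shift_incl V d.+1 g x =
    shift_unit _ g y - shift_unit _ g (y - shift_incl V d g x).
  by rewrite linearB opprB addrCA subrr addr0.
by rewrite rpredB //; exact: lt_sub_mor.
Qed.

Lemma ses_iter U V W d :
  ses U V W -> ses (iter d shift U) (iter d shift V) (iter d shift W).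
Proof. by move=> E; elim: d => //= d; exact: ses_shift. Qed.

Lemma shift_iter_ext N V : gen_lt V N -> loc_noetherian V ->
  exists D, forall d, (D <= d)%N -> iter_ext (iter d shift V).
Proof.
move=> VN Vn; suff [D SD] : exists D, iter_ext (iter D shift V).
  by exists D => d /subnK<-; rewrite iterD; exact: iter_ext_iter.
elim: N V VN Vn => [|g IHg] V VN Vn.
  by exists 0; apply/IterExtZero/gen_lt0.
have [D DV] := shift_stable VN Vn; set V' := iter D shift V in DV.
have V'n : loc_noetherian V' := loc_noetherian_iter Vn.
have [E SE] := IHg (cm_sub (lt_sub V' g)) (@gen_lt_sub k V' g)
  (loc_noetherian_inj (@cm_val_inj _ _ _) V'n).
(* After [D] shifts the quotient by the part generated below [g] is basic; the [E] further shifts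
   demanded by that part keep the quotient an iterated extension. *)
exists (E + D)%N; rewrite iterD -/V'.
apply: (iter_ext_ses SE _ (ses_iter E (ses_quot (lt_sub V' g)))).
apply: iter_ext_iter; apply: iter_ext_iso (iter_ext_basic _).
exact/cm_iso_sym/(stable_top DV)/gen_lt_iter.
Qed.
End ShiftTheorem.

(** * Finite generation, filtrations, generating degree *)

Section FiniteGeneration.
Variable k : comPzRingType.
Implicit Types U V W Q : cmodule k.

Definition sum_inl U W n (x : U n) : cm_sum U W n := (x, 0).
Fact sum_inl_linear U W n : linear (@sum_inl U W n).
Proof. by move=> a x y; congr pair; rewrite /= scaler0 addr0. Qed.
HB.instance Definition _ U W n := GRing.isLinear.Build k (U n) (cm_sum U W n) *:%R
  (@sum_inl U W n) (@sum_inl_linear U W n).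
Fact sum_inl_nat U W m n (f : inj m n) x :
  @sum_inl U W n (cm_act U f x) = cm_act (cm_sum U W) f (@sum_inl U W m x).
Proof. by congr pair; rewrite /= linear0. Qed.
Definition cm_inl U W : cmor U (cm_sum U W) :=
  @Cmor k U (cm_sum U W) (fun n => @sum_inl U W n) (@sum_inl_nat U W).

Definition sum_inr U W n (x : W n) : cm_sum U W n := (0, x).
Fact sum_inr_linear U W n : linear (@sum_inr U W n).
Proof. by move=> a x y; congr pair; rewrite /= scaler0 addr0. Qed.
HB.instance Definition _ U W n := GRing.isLinear.Build k (W n) (cm_sum U W n) *:%R
  (@sum_inr U W n) (@sum_inr_linear U W n).
Fact sum_inr_nat U W m n (f : inj m n) x :
  @sum_inr U W n (cm_act W f x) = cm_act (cm_sum U W) f (@sum_inr U W m x).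
Proof. by congr pair; rewrite /= linear0. Qed.
Definition cm_inr U W : cmor W (cm_sum U W) :=
  @Cmor k W (cm_sum U W) (fun n => @sum_inr U W n) (@sum_inr_nat U W).

Lemma cm_sum_split U W n (x : cm_sum U W n) :
  x = cm_inl U W n x.1 + cm_inr U W n x.2.
Proof. by case: x => x y; congr pair; rewrite /= ?addr0 ?add0r. Qed.

Section Copair.
Variables (U W V : cmodule k) (f : cmor U V) (g : cmor W V).
Definition copair_at n (x : cm_sum U W n) : V n := f n x.1 + g n x.2.
Fact copair_linear n : linear (@copair_at n).
Proof. by move=> a x y; rewrite /copair_at !linearP scalerDr addrACA. Qed.
HB.instance Definition _ n := GRing.isLinear.Build k (cm_sum U W n) (V n) *:%R
  (@copair_at n) (@copair_linear n).
Fact copair_nat m n (a : inj m n) x :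
  copair_at (cm_act (cm_sum U W) a x) = cm_act V a (copair_at x).
Proof. by rewrite /copair_at linearD -!cmor_nat. Qed.
Definition copair : cmor (cm_sum U W) V :=
  @Cmor k (cm_sum U W) V (fun n => @copair_at n) copair_nat.
End Copair.

Definition free_sum (s : seq nat) : cmodule k :=
  foldr (@cm_sum k) (cm_zero k) [seq cm_free k i | i <- s].

Lemma gen_lt_sum U W N : gen_lt U N -> gen_lt W N -> gen_lt (cm_sum U W) N.
Proof.
move=> UN WN n x; rewrite [x]cm_sum_split rpredD //; exact: lt_sub_mor.
Qed.

Lemma fg_sum U W n : fg_module (U n) -> fg_module (W n) -> fg_module (cm_sum U W n).
Proof.
move=> [s sE] [t tE]; exists (map (cm_inl U W n) s ++ map (cm_inr U W n) t) => x.
rewrite [x]cm_sum_split rpredD //.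
  apply: seq_span_sub (seq_span_lin (cm_inl U W n) (sE _)) => y ys.
  by rewrite mem_cat ys.
apply: seq_span_sub (seq_span_lin (cm_inr U W n) (tE _)) => y ys.
by rewrite mem_cat ys orbT.
Qed.

Lemma gen_lt_free i : gen_lt (cm_free k i) i.+1.
Proof.
move=> n u; rewrite [u]tens_sum rpred_sum // => a _.
rewrite -[a in tens_pure a]inj1M -push_tens.
exact: (lt_sub_act (V := cm_free k i)).
Qed.

Lemma fg_free i n : fg_module (cm_free k i n).
Proof.
exists [seq tens_pure a (1 : k^o) | a <- enum {: inj i n}] => u.
rewrite [u]tens_sum rpred_sum // => a _.
rewrite (_ : u a = u a *: (1 : k^o)) ?linearZ; last by rewrite -[RHS]/(u a * 1) mulr1.
apply/rpredZ/mem_submod_span/map_f; exact: mem_enum.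
Qed.

Lemma free_sum_fin s :
  (exists N, gen_lt (free_sum s) N) /\ forall n, fg_module (free_sum s n).
Proof.
elim: s => [|i s [[N sN] fs]].
  split=> [|n]; first by exists 0; apply/gen_lt0 => n x; exact: thinmx0.
  by exists [::] => x; rewrite [x]thinmx0 rpred0.
split=> [|n]; last by apply: fg_sum => //; exact: fg_free.
exists (maxn i.+1 N); apply: gen_lt_sum.
  exact: gen_lt_leq (leq_maxl _ _) (@gen_lt_free i).
exact: gen_lt_leq (leq_maxr _ _) sN.
Qed.

Lemma fin_gen_gen V : noetherian k -> fin_gen V ->
  (exists N, gen_lt V N) /\ loc_noetherian V.
Proof.
move=> kN [s [p pS]]; have [[N sN] fs] := free_sum_fin s; split.
  by exists N; exact: gen_lt_surj pS sN.
move=> n; apply: (fg_noetherian kN); exact: fg_surj (pS n) (fs n).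
Qed.

Lemma free_sum_extend V s (p : cmor (free_sum s) V) j (t : seq (V j)) :
  exists s' (p' : cmor (free_sum s') V),
    (forall n, {subset submod_pred (cm_im p n) <= submod_pred (cm_im p' n)}) /\
    {subset t <= submod_pred (cm_im p' j)}.
Proof.
elim: t => [|x t [s' [p' [pp' tp']]]]; first by exists s, p; split=> [n y|y].
pose q := ind_map (Q := V) (scalel x : {linear k^o -> V j}).
have pq n y : y \in submod_pred (cm_im p' n) -> y \in submod_pred (cm_im (copair q p') n).
  move=> /im_submodP[z ->]; apply/im_submodP; exists (cm_inr _ _ n z).
  by rewrite /= /copair_at /= linear0 add0r.
exists (j :: s'), (copair q p'); split=> [n y /pp'/pq //|y].
rewrite inE => /predU1P[->|/tp'/pq //]; apply/im_submodP.
exists (cm_inl (cm_free k j) (free_sum s') j (tens_pure (inj1 j) (1 : k^o))).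
rewrite /= /copair_at /= linear0 addr0 ind_map_tens cm_act1.
by rewrite /= /scalel scale1r.
Qed.

(** Finitely many degrees suffice, each with finitely many generators. Together with [fin_gen_gen]
    it replaces finite generation by two conditions that are easy to follow through shifts and
    cokernels. *)
Lemma fin_gen_crit V N : gen_lt V N -> loc_noetherian V -> fin_gen V.
Proof.
move=> VN Vn.
suff [s [p sp]] : exists s (p : cmor (free_sum s) V),
    forall j, (j < N)%N -> forall x, x \in submod_pred (cm_im p j).
  exists s, p => n x; suff /im_submodP[y ->] : x \in submod_pred (cm_im p n) by exists y.
  by apply: lt_sub_min (VN n x) => j a y /sp jp; apply: sm_act.
elim: N {VN} => [|N [s [p sp]]]; first by exists [::], (cmor_zero _ _).
have [t tE] := noetherian_fg (Vn N).
have [s' [p' [pp' tp']]] := free_sum_extend p t; exists s', p' => j.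
rewrite ltnS leq_eqVlt => /orP[/eqP jN|/sp jp] x; last exact/pp'.
by subst j; apply: submod_span_le (tE x) => y /tp'.
Qed.

(** A module vanishing from degree [N] on is generated below [N]. *)
Lemma torsion_crit V N : loc_noetherian V ->
  (forall n, (N <= n)%N -> forall x : V n, x = 0) -> torsion V.
Proof.
move=> Vn V0; split; last by exists N.
apply: (@fin_gen_crit V N) => // n x.
case: (ltnP n N) => [nN|Nn]; first exact: lt_sub_low.
by rewrite (V0 n Nn x) rpred0.
Qed.

Lemma loc_noetherian_sub V (W : submodule V) :
  loc_noetherian V -> loc_noetherian (cm_sub W).
Proof. exact/loc_noetherian_inj/cm_val_inj. Qed.

Lemma loc_noetherian_quot V (W : submodule V) :
  loc_noetherian V -> loc_noetherian (cm_quot W).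
Proof. exact/loc_noetherian_surj/cm_pi_surj. Qed.

Lemma torsion_homology U V W (f : cmor U V) (g : cmor V W) N : loc_noetherian V ->
    (forall n, (N <= n)%N -> forall x, g n x = 0 -> exists y, x = f n y) ->
  torsion (homology f g).
Proof.
move=> Vn fg; apply: (@torsion_crit _ N).
  exact/loc_noetherian_quot/loc_noetherian_sub.
move=> n Nn x; have [y <-] := cm_pi_surj x; apply/quot_pi0.
by apply/im_submodP/(fg n Nn)/eqP; exact: (valP y).
Qed.

End FiniteGeneration.

(** * From iterated extensions to filtrations by submodules *)

Section Filtration.
Variable k : comPzRingType.
Implicit Types U V W Q : cmodule k.

(** Both sides embed in [cm_quot W] with the same image, namely that of [W']. *)
Lemma cm_subquot_iso V (W' W : submodule V) B (h : cmor B (cm_quot W)) :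
    cm_inj h ->
    (forall n z, (exists b, z = h n b) <->
                 exists2 x, x \in submod_pred (W' n) & z = cm_pi W n x) ->
  cm_iso (cm_subquot W' W) B.
Proof.
move=> hI hE; pose p := cm_pi (sm_restrict W' W).
have pS : cm_surj p := @cm_pi_surj _ _ _.
have [|j jE] := @cmor_factor _ _ _ _ p (cmor_comp (cm_pi W) (cm_val W')) pS.
  by move=> n x /quot_pi0 xW; apply: quot_pi_eq0.
apply: (cm_iso_image (f := j) (g := h)) => // [|n x|n b].
- apply: cm_inj0 => n x; have [y <-] := pS n x; rewrite jE => /quot_pi0 yW.
  exact: quot_pi_eq0.
- have [y <-] := pS n x; rewrite jE; apply/hE.
  by exists (val y) => //; exact: valP.
- have [x xW ->] := (hE n (h n b)).1 (ex_intro _ b erefl).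
  by exists (p n (Sub x xW)); rewrite jE.
Qed.

(** The subquotient is described by an embedding into [cm_quot W], a form easier to push along an
    injective morphism than an isomorphism with [cm_subquot]. *)
Definition filtration_step V (W W' : submodule V) :=
  (forall n, {subset submod_pred (W n) <= submod_pred (W' n)}) /\
  exists i (T : kSmodule k i) (h : cmor (basic T) (cm_quot W)), cm_inj h /\
    forall n z, (exists b, z = h n b) <->
                exists2 x, x \in submod_pred (W' n) & z = cm_pi W n x.

Definition sm_image U V (f : cmor U V) (W : submodule U) : submodule V :=
  cm_im (cmor_comp f (cm_val W)).

Lemma sm_imageP U V (f : cmor U V) (W : submodule U) n x :
  x \in submod_pred (sm_image f W n) <-> exists2 y, y \in submod_pred (W n) & x = f n y.
Proof.
split=> [/im_submodP[y ->]|[y yW ->]]; first by exists (val y) => //; exact: valP.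
by apply/im_submodP; exists (Sub y yW).
Qed.

Lemma filtration_step_image U V (f : cmor U V) (W W' : submodule U) : cm_inj f ->
  filtration_step W W' -> filtration_step (sm_image f W) (sm_image f W').
Proof.
move=> fI [WW' [i [T [h [hI hE]]]]]; split=> [n x /sm_imageP[y /WW' yW ->]|].
  by apply/sm_imageP; exists y.
have [|q qE] := @cmor_factor _ _ _ _ (cm_pi W) (cmor_comp (cm_pi (sm_image f W)) f)
  (@cm_pi_surj _ _ _).
  by move=> n x /quot_pi0 xW; apply/quot_pi_eq0/sm_imageP; exists x.
exists i, T, (cmor_comp q h); split=> [|n z].
  apply: cm_inj0 => n b /=; have [x _ hx] := (hE n (h n b)).1 (ex_intro _ b erefl).
  rewrite hx qE => /quot_pi0/sm_imageP[y yW /fI xy].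
  by apply: (hI n); rewrite linear0 hx xy; exact: quot_pi_eq0.
split=> [[b ->]|[x /sm_imageP[y yW' ->] ->]].
  have [x xW' hx] := (hE n (h n b)).1 (ex_intro _ b erefl).
  by exists (f n x); [apply/sm_imageP; exists x | rewrite /= hx qE].
have [b hb] := (hE n (cm_pi W n y)).2 (ex_intro2 _ _ y yW' erefl).
by exists b; rewrite /= -hb qE.
Qed.

Lemma iter_ext_filtration V : iter_ext V -> exists (s : nat) (W : nat -> submodule V),
  [/\ forall n x, x \in submod_pred (W 0 n) -> x = 0,
      forall n x, x \in submod_pred (W s n) &
      forall j, (j < s)%N -> filtration_step (W j) (W j.+1)].
Proof.
elim=> {}V => [V0|U i T _ [s [W [W0 Ws Wj]]] [f [g [fI fg gS]]]].
  by exists 0, (fun=> cm_im (cmor_id V)); split=> // n x; rewrite [x]V0 ?rpred0.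
(* The filtration of [U] is carried into [V], and [V] itself, as the image of the identity, is put
   on top. *)
pose W' j := if (j <= s)%N then sm_image f (W j) else cm_im (cmor_id V).
have W'le j : (j <= s)%N -> W' j = sm_image f (W j) by rewrite /W' => ->.
have W'last : W' s.+1 = cm_im (cmor_id V) by rewrite /W' ltnn.
exists s.+1, W'; split=> [n x|n x|j].
- by rewrite W'le // => /sm_imageP[y /W0 -> ->]; exact: linear0.
- by rewrite W'last; apply/im_submodP; exists x.
rewrite ltnS leq_eqVlt => /orP[/eqP->|js]; last first.
  by rewrite (W'le j.+1 js) (W'le j (ltnW js)); exact/filtration_step_image/Wj.
rewrite (W'le s (leqnn s)) W'last.
have fullP n x : x \in submod_pred (cm_im (cmor_id V) n).
  by apply/im_submodP; exists x.
split=> [n x _|]; first exact: fullP.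
(* Since [W s] is all of [U], the top quotient is the cokernel of [f], that is, the basic module. *)
have [|h [hI hS]] := cm_iso_ind
  (@ses_coker _ _ _ _ (cmor_comp f (cm_val (W s))) g _ gS).
  move=> n x; rewrite fg; split=> [[y ->]|[y ->]]; last by exists (val y).
  by exists (Sub y (Ws n y)).
exists i, T, h; split=> // n z; split=> [[b ->]|[x _ ->]].
  by have [x <-] := cm_pi_surj (h n b); exists x.
by have [b <-] := hS n (cm_pi _ n x); exists b.
Qed.

Lemma iter_ext_sharp V : fin_gen V -> iter_ext V -> sharp_filtered V.
Proof.
move=> Vf /iter_ext_filtration[s [W [W0 Ws Wj]]]; split=> //; exists s, W; split=> // j js.
have [WW [i [T [h [hI hE]]]]] := Wj j js; split=> //; exists i, T.
exact: cm_subquot_iso hI hE.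
Qed.
End Filtration.

Section GeneratingDegree.
Variable k : comPzRingType.
Implicit Types V : cmodule k.

Lemma gen_lt_H0 V N j : gen_lt V N -> nonzero (H0 V j) -> (j < N)%N.
Proof.
move=> VN [x x0]; rewrite ltnNge; apply/negP => Nj; apply: x0.
rewrite -[x]quot_reprK; apply: quot_pi_eq0.
exact: (gen_lt_leq Nj VN).
Qed.

(** Nakayama by strong induction on the degree: where H_0 vanishes, elements come from lower
    degrees, which are already generated below [N]. *)
Lemma H0_gen_lt V N : (forall j, nonzero (H0 V j) -> (j < N)%N) -> gen_lt V N.
Proof.
move=> VN n; elim/ltn_ind: n => n IHn x; case: (ltnP n N) => [nN|Nn].
  exact: lt_sub_low.
have : x \in submod_pred (lt_sub V n n).
  apply/quot_pi0; apply: contrapT => x0.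
  have : nonzero (H0 V n) by exists (quot_pi (lt_sub V n n) x).
  by move=> /VN; rewrite ltnNge Nn.
by move: x; apply: lt_sub_min => j a y /IHn jN; apply: sm_act.
Qed.

Lemma gd_gen_lt V N : gen_lt V N -> gd V = -oo%E \/
  exists2 i, gd V = (i%:Z%:E)%E & (i < N)%N /\ gen_lt V i.+1.
Proof.
move=> VN; have := gdP V; case: (gd V) => [d [i [-> Vi mi]]|/(_ N)[j Nj]|]; last by left.
  right; exists i => //; split; first exact: gen_lt_H0 VN Vi.
  by apply: H0_gen_lt => j /mi.
by move=> /(gen_lt_H0 VN); rewrite ltnNge Nj.
Qed.

Lemma gdNy V : gd V = -oo%E -> is_zero V.
Proof.
move=> V0; have := gdP V; rewrite V0 => /= H; apply/gen_lt0/H0_gen_lt => j /H //.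
Qed.

End GeneratingDegree.

(** * The complex *)

Section Complex.
Variable k : comPzRingType.
Implicit Types U V W Q : cmodule k.
Notation shift := (@cm_shift k).

(** A permutation of the target moving [f ord0] to 0 turns [f] into an [inj_iota], whose action is
    an action on the shift. *)
Lemma torsion_free_unshift V N :
  torsion_free_from (cm_shift V) N -> torsion_free_from V N.+1.
Proof.
move=> Vt [|n] [|m] f Nn //; first by have := inj_size_leq f.
have [t [tf _]] := inj_swap0 (f ord0).
have [|g gE] := (inj_fix0 (injM t f)).1; first by rewrite injME.
move=> x y /(congr1 (cm_act V t)); rewrite -!cm_actM gE; exact: (Vt n m g).
Qed.

Lemma torsion_free_iter V N d :
  torsion_free_from (iter d shift V) N -> torsion_free_from V (N + d)%N.
Proof.
elim: d N => [|d IHd] N; first by rewrite addn0.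
by move=> /torsion_free_unshift/IHd; rewrite addSnnS.
Qed.

Lemma torsion_free_shift V N :
  torsion_free_from V N -> torsion_free_from (cm_shift V) N.
Proof. by move=> Vt n m f Nn; apply: Vt; exact: leqW. Qed.

Lemma shift_incl_inj V N d n : torsion_free_from V N -> (N <= n)%N ->
  injective (shift_incl V d n).
Proof.
move=> Vt Nn; elim: d => [|d IHd] x y //= /[dup] + _.
have Vdt : torsion_free_from (iter d shift V) N.
  by elim: d {IHd x y} => //= d; exact: torsion_free_shift.
by move=> /(Vdt _ _ _ Nn)/IHd.
Qed.

Variables (D : cmodule k -> nat) (V : cmodule k).

(** [D] chooses a number of shifts for every module at once, so that taking cokernels can be
    iterated. *)
Definition shift_coker U : cmodule k := cm_quot (cm_im (shift_incl U (D U))).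
Definition coker_iter i : cmodule k := iter i shift_coker V.
Definition complex_term i : cmodule k := iter (D (coker_iter i)) shift (coker_iter i).
Definition coker_iter_incl i : cmor (coker_iter i) (complex_term i) :=
  shift_incl (coker_iter i) (D (coker_iter i)).
Definition coker_iter_proj i : cmor (complex_term i) (coker_iter i.+1) :=
  cm_pi (cm_im (coker_iter_incl i)).

(** The complex is spliced from the sequences in which [coker_iter i] maps to [complex_term i] and
    this onto [coker_iter i.+1]. *)
Definition complex_diff i : cmor (coaug V complex_term i) (coaug V complex_term i.+1) :=
  match i with
  | 0 => cmor_zero (cm_zero k) V
  | 1 => coker_iter_incl 0
  | i.+2 => cmor_comp (coker_iter_incl i.+1) (coker_iter_proj i)
  end.

Lemma coker_iter_proj_incl i n x : coker_iter_proj i n (coker_iter_incl i n x) = 0.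
Proof. by apply/quot_pi0/im_submodP; exists x. Qed.

Lemma complex_diff2 i n (x : coaug V complex_term i n) :
  complex_diff i.+1 n (complex_diff i n x) = 0.
Proof.
case: i x => [|[|i]] x; first exact: linear0.
  by rewrite /= coker_iter_proj_incl linear0.
by rewrite [complex_diff i.+2 n x]/= /= coker_iter_proj_incl linear0.
Qed.

Lemma coker_iter_gen N i : gen_lt V N -> gen_lt (coker_iter i) (N - i).
Proof.
move=> VN; elim: i => [|i IHi]; first by rewrite subn0.
by rewrite subnS; exact: shift_coker_gen.
Qed.

Lemma coker_iter_noetherian i : loc_noetherian V -> loc_noetherian (coker_iter i).
Proof.
move=> Vn; elim: i => // i IHi; exact/loc_noetherian_quot/loc_noetherian_iter.
Qed.

Hypothesis Vn : loc_noetherian V.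
Hypothesis DV : forall i, iter_ext (complex_term i).

Lemma complex_homology i : torsion (homology (complex_diff i) (complex_diff i.+1)).
Proof.
(* The chosen shift of the cokernel is torsion free in all degrees; undoing each shift raises the
   bound by one. From that bound on the inclusion into the term is injective. *)
have tf j : torsion_free_from (coker_iter j) (D (coker_iter j)).
  rewrite -[X in torsion_free_from _ X]add0n.
  exact: torsion_free_iter (iter_ext_torsion_free (DV j)).
case: i => [|i].
  apply: (torsion_homology (N := D V)) => // n nD x x0; exists 0; rewrite linear0.
  by apply: (shift_incl_inj (tf 0) nD (d := D V)); rewrite linear0; exact: x0.
apply: (torsion_homology (N := D (coker_iter i.+1))).
  exact/loc_noetherian_iter/coker_iter_noetherian.
move=> n nD x x0.
have /quot_pi0/im_submodP[y ->] : coker_iter_proj i n x = 0.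
  apply: (shift_incl_inj (tf i.+1) nD (d := D (coker_iter i.+1))).
  by rewrite linear0; exact: x0.
(* At the first term [y] lies in [V]; at later terms it lifts along the projection from the
   preceding term. *)
case: i {x x0 nD} y => [|i] y; first by exists y.
by have [z <-] := cm_pi_surj y; exists z.
Qed.
End Complex.

(* The i-th spot of the complex carries cm_zero, V, F 0, F 1, ... for
   i = 0, 1, 2, 3, ...; so homology (d 0) (d 1) is the homology at V and
   homology (d i.+1) (d i.+2) the homology at F i.  For V = 0 one has
   gd V = -oo, which forces all F i to be zero. *)
Theorem theorem1p7 (k : comPzRingType) (V : cmodule k) :
  noetherian k -> fin_gen V ->
  (exists (n : nat) (F : nat -> cmodule k)
          (d : forall i, cmor (coaug V F i) (coaug V F i.+1)),
     [/\ (forall i, (n < i)%N -> is_zero (F i)),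
         (forall i m (x : coaug V F i m), d i.+1 m (d i m x) = 0),
         (forall i, (i <= n)%N ->
            sharp_filtered (F i) /\ (gd (F i) <= gd V - i%:Z%:E)%E),
         (~ is_zero V -> (n%:Z%:E <= gd V)%E) &
         (forall i, torsion (homology (d i) (d i.+1)))]) /\
  (exists D : nat, forall d, (D <= d)%N -> sharp_filtered (iter d (@cm_shift k) V)).
Proof.
move=> kN Vf; have [[M VM] Vn] := fin_gen_gen kN Vf; split; last first.
  have [D SD] := shift_iter_ext VM Vn; exists D => d /SD; apply: iter_ext_sharp.
  exact: (fin_gen_crit (gen_lt_iter VM) (loc_noetherian_iter Vn)).
(* Choice over all modules; the value 0 is taken where the shift theorem does not apply. *)
have /boolp.choice[D SD] U : exists d,
    (exists N, gen_lt U N) /\ loc_noetherian U -> iter_ext (iter d (@cm_shift k) U).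
  have [[[N UN] Un]|nU] := pselect ((exists N, gen_lt U N) /\ loc_noetherian U).
    by have [D SD] := shift_iter_ext UN Un; exists D => _; exact: SD.
  by exists 0.
have FS i : iter_ext (complex_term D V i).
  apply: SD; split; last exact: coker_iter_noetherian.
  by exists (M - i)%N; exact: coker_iter_gen.
(* [N] is the sharp bound: 0 for zero [V], and one more than the generating degree otherwise. *)
have [N [VN NV Ngd]] : exists N, [/\ gen_lt V N, ~ is_zero V -> (0 < N)%N &
    (0 < N)%N -> gd V = (N.-1%:Z%:E)%E].
  have [/gdNy V0|[i gV [_ Vi]]] := gd_gen_lt VM; last by exists i.+1.
  by exists 0; split=> //; exact/gen_lt0.
have FN i : gen_lt (complex_term D V i) (N - i) by exact/gen_lt_iter/coker_iter_gen.
(* For zero [V] the predecessor truncates to 0, and the remaining term [F 0] is zero. *)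
exists N.-1, (complex_term D V), (complex_diff D V); split.
- move=> i iN; apply/gen_lt0; have := FN i.
  rewrite (_ : (N - i)%N = 0) //; apply/eqP; rewrite subn_eq0.
  by case: N iN {VN NV Ngd FN}.
- exact: complex_diff2.
- move=> i iN; split.
    apply: iter_ext_sharp (FS i); apply: fin_gen_crit (FN i) _.
    exact/loc_noetherian_iter/coker_iter_noetherian.
  (* The term is generated below [N - i], so its generating degree is -oo or at most [N - 1 - i]. *)
  have [->|[j -> [jN _]]] := gd_gen_lt (FN i); first exact: leNye.
  case: N jN iN Ngd {VN NV FN} => [|N] //= jN iN -> //.
  rewrite -EFinB lee_fin subzn // lez_nat; by rewrite subSn in jN.
- by move=> /NV N0; rewrite Ngd.
- by move=> i; exact: complex_homology.
Qed.
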